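(* There exist absolute constants $C, c > 0$ such that the following holds. Let $0<s<d$, $0<\nu\le L$, let $f\in\mathcal{F}_{L,\nu,d}\cap CG_{s,d}$, and let $\mathcal{C}_f(\cdot,\cdot)$ be a polynomial comparison oracle for $f$ with $\kappa=1$ and $0<\delta_0<\mu\le 0.5$. Fix a target solution accuracy $\varepsilon>0$ and a target gradient accuracy $0<\eta<1$. Let $\mathbf{x}\in\mathbb{R}^d$, $\mathbf{g}=\nabla f(\mathbf{x})$, and suppose $\|\mathbf{g}\|_2\ge\varepsilon\nu/2$. Let $\hat{\mathbf{g}}$ be the output of 1BitGradEst$(\mathbf{x},s,m,r)$ with parameters $$m\ge 4C\eta^{-4}\delta_0^{-2}s\log(2d/s)\qquad\text{and}\qquad r=\frac{\varepsilon\nu}{2L\sqrt d}.$$ Then $$\left\|\hat{\mathbf{g}}-\frac{\mathbf{g}}{\|\mathbf{g}\|_2}\right\|_2\le\eta$$ holds with probability at least $1-8\exp\left(-c\eta^4s\log(2d/s)\right)$.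
   Context: Function classes. $CG_{s,d}$ is the set of all (differentiable) $f:\mathbb{R}^d\to\mathbb{R}$ with $\|\nabla f(\mathbf{x})\|_1\le\sqrt{s}\,\|\nabla f(\mathbf{x})\|_2$ for all $\mathbf{x}\in\mathbb{R}^d$. For $0<\nu\le L$, $\mathcal{F}_{L,\nu,d}$ is the set of all $f:\mathbb{R}^d\to\mathbb{R}$ that are twice continuously differentiable, convex, $L$-Lipschitz differentiable ($\|\nabla f(\mathbf{x})-\nabla f(\mathbf{y})\|_2\le L\|\mathbf{x}-\mathbf{y}\|_2$ for all $\mathbf{x},\mathbf{y}$), and $\nu$-restricted-strongly convex: $f(\mathbf{x})-f^\star\ge\frac{\nu}{2}\|\mathbf{x}-\mathrm{P}_\star(\mathbf{x})\|_2^2$ for all $\mathbf{x}\in\mathbb{R}^d$. Here $f^\star=\min_{\mathbf{x}\in\mathbb{R}^d}f(\mathbf{x})$ (assumed attained), $\mathcal{X}=\arg\min f$ is the (nonempty, closed, convex) solution set, and $\mathrm{P}_\star(\mathbf{x})=\arg\min_{\mathbf{z}\in\mathcal{X}}\|\mathbf{x}-\mathbf{z}\|_2$ is the projection onto it. Oracle. A polynomial comparison oracle for $f$ with parameters $0<\delta_0\le 1/2$, $\mu>0$, $\kappa\ge1$ returns, for each query $(\mathbf{x},\mathbf{y})$, a random value $\mathcal{C}_f(\mathbf{x},\mathbf{y})\in\{-1,+1\}$ with $$\mathbb{P}\left[\mathcal{C}_f(\mathbf{x},\mathbf{y})=\mathrm{sign}(f(\mathbf{y})-f(\mathbf{x}))\right]\ge\tfrac12+\min\{\delta_0,\mu|f(\mathbf{y})-f(\mathbf{x})|^{\kappa-1}\}.$$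 Signs are regarded as taking values in $\{-1,+1\}$ (with a fixed convention for $\mathrm{sign}(0)$). For $\kappa=1$ and $\delta_0<\mu$ this lower bound is $\frac12+\delta_0$, and the oracle is understood to be correct with a constant probability not depending on the points queried. The randomness of the oracle is independent across queries and independent of all other random choices. Algorithm 1BitGradEst$(\mathbf{x},s,m,r)$. Draw $\mathbf{z}_1,\dots,\mathbf{z}_m$ independently and uniformly from the unit sphere $\mathbb{S}^{d-1}\subset\mathbb{R}^d$; query $y_i=\mathcal{C}_f(\mathbf{x},\mathbf{x}+r\mathbf{z}_i)$ for $i=1,\dots,m$; output $$\hat{\mathbf{g}}\in\arg\max\Big\{\sum_{i=1}^m y_i\mathbf{z}_i^\top\mathbf{g}' : \|\mathbf{g}'\|_1\le\sqrt{s},\ \|\mathbf{g}'\|_2\le1\Big\}.$$ *)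

(* Defs.v *)
From HB Require Import structures.
From mathcomp Require Import all_boot all_order all_algebra.
From mathcomp Require Import all_classical all_reals all_analysis.
Set Implicit Arguments.
Unset Strict Implicit.
Unset Printing Implicit Defensive.
Import Order.TTheory GRing.Theory Num.Theory.
Import numFieldNormedType.Exports.
Local Open Scope classical_set_scope.
Local Open Scope ring_scope.

(* Points of R^d are row vectors.  The library norm on 'rV[R]_d is the sup
   norm; it induces the Euclidean topology, so [differentiable], [continuous]
   and [open] have their usual meaning, but metric quantities must go through
   [l1norm] and [l2norm]. *)
Definition dotp (R : realType) (d : nat) (u v : 'rV[R]_d) : R :=
  \sum_(i < d) u ord0 i * v ord0 i.

Definition l1norm (R : realType) (d : nat) (u : 'rV[R]_d) : R :=
  \sum_(i < d) `|u ord0 i|.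

Definition l2norm (R : realType) (d : nat) (u : 'rV[R]_d) : R :=
  Num.sqrt (\sum_(i < d) u ord0 i ^+ 2).

Definition gradient (R : realType) (d : nat) (f : 'rV[R]_d -> R)
    (x : 'rV[R]_d) : 'rV[R]_d :=
  \row_(i < d) 'D_(delta_mx ord0 i) f x.

(* The Hessian is the Jacobian of the gradient. *)
Definition twice_cont_differentiable (R : realType) (d : nat)
    (f : 'rV[R]_d -> R) : Prop :=
  [/\ forall x, differentiable f x,
      forall x, differentiable (gradient f) x
    & continuous (jacobian (gradient f))].

Definition CG (R : realType) (d : nat) (s : R) (f : 'rV[R]_d -> R) : Prop :=
  (forall x, differentiable f x) /\
  forall x, l1norm (gradient f x) <= Num.sqrt s * l2norm (gradient f x).

Definition argmin (R : realType) (d : nat) (f : 'rV[R]_d -> R) :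
    set 'rV[R]_d :=
  [set x | forall y, f x <= f y].

Definition is_projection (R : realType) (d : nat) (X : set 'rV[R]_d)
    (x p : 'rV[R]_d) : Prop :=
  X p /\ forall z, X z -> l2norm (x - p) <= l2norm (x - z).

(* The projection is used as a relation: in [F_class], [argmin f] is nonempty,
   closed and convex, so every x has exactly one projection p on it. *)
Definition restricted_strongly_convex (R : realType) (d : nat) (nu : R)
    (f : 'rV[R]_d -> R) : Prop :=
  forall x p, is_projection (argmin f) x p ->
    nu / 2 * l2norm (x - p) ^+ 2 <= f x - inf (range f).

Record F_class (R : realType) (d : nat) (L nu : R) (f : 'rV[R]_d -> R) :
    Prop := {
  F_min_attained : argmin f !=set0 ;
  F_C2 : twice_cont_differentiable f ;
  F_convex : convex_function [set: 'rV[R]_d] f ;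
  F_lipschitz_gradient : forall x y,
    l2norm (gradient f x - gradient f y) <= L * l2norm (x - y) ;
  F_restricted_strongly_convex : restricted_strongly_convex nu f }.

Definition borel_rV (R : realType) (d : nat) :=
  g_sigma_algebraType (@open 'rV[R]_d).

(* The uniform law on the unit sphere is the unique probability carried by the
   sphere that is invariant under the orthogonal group. *)
Definition uniform_on_sphere (R : realType) (d : nat)
    (sigma : probability (borel_rV R d) R) : Prop :=
  sigma [set v : 'rV[R]_d | l2norm v = 1] = 1%E /\
  forall O : 'M[R]_d, O *m O^T = 1%:M ->
  forall A : set (borel_rV R d), measurable A ->
    sigma [set v : 'rV[R]_d | A (v *m O)] = sigma A.

(* Sign with values in {-1, +1}; the Boolean b fixes the convention
   sign(0) = (-1)^b. *)
Definition sign_pm (R : realType) (b : bool) (t : R) : R :=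
  if t == 0 then (-1) ^+ b else Num.sg t.

(* The randomness of a single query is a seed w with law Q: the random value
   returned for the query (x, y) is [oracle w x y], w drawn from Q. *)
Definition correct_answer (R : realType) (d : nat) (dW : measure_display)
    (W : measurableType dW) (b : bool) (f : 'rV[R]_d -> R)
    (oracle : W -> 'rV[R]_d -> 'rV[R]_d -> R) (x y : 'rV[R]_d) : set W :=
  [set w | oracle w x y = sign_pm b (f y - f x)].

Record poly_comparison_oracle (R : realType) (d : nat) (dW : measure_display)
    (W : measurableType dW) (b : bool) (f : 'rV[R]_d -> R)
    (Q : probability W R) (oracle : W -> 'rV[R]_d -> 'rV[R]_d -> R)
    (delta0 mu kappa : R) : Prop := {
  oracle_delta0 : 0 < delta0 <= 2^-1 ;
  oracle_mu : 0 < mu ;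
  oracle_kappa : 1 <= kappa ;
  oracle_pm1 : forall w x y, oracle w x y = 1 \/ oracle w x y = -1 ;
  oracle_measurable : measurable_fun
    [set: W * (borel_rV R d * borel_rV R d)]
    (fun t => oracle t.1 t.2.1 t.2.2) ;
  oracle_correct : forall x y,
    ((2^-1 + Num.min delta0 (mu * `|f y - f x| `^ (kappa - 1)))%:E
       <= Q (correct_answer b f oracle x y))%E }.

Definition constant_accuracy (R : realType) (d : nat) (dW : measure_display)
    (W : measurableType dW) (b : bool) (f : 'rV[R]_d -> R)
    (Q : probability W R) (oracle : W -> 'rV[R]_d -> 'rV[R]_d -> R) : Prop :=
  exists p : R, forall x y, Q (correct_answer b f oracle x y) = p%:E.

Definition events_of (dT dU : measure_display) (T : measurableType dT)
    (U : measurableType dU) (X : T -> U) : set (set T) :=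
  preimage_set_system [set: T] X measurable.

Definition mutually_independent (R : realType) (dT : measure_display)
    (T : measurableType dT) (P : probability T R) (I : finType)
    (F : I -> set (set T)) : Prop :=
  forall (J : {set I}) (A : I -> set T), (forall i, i \in J -> F i (A i)) ->
    P (\bigcap_(i in [set` J]) A i) = (\prod_(i in J) P (A i))%E.

(* The randomness consumed by m oracle queries along random directions: the
   directions z_i are uniform on the sphere, the i-th query uses its own seed
   w_i of law Q, and all z_i and w_i together are mutually independent. *)
Record direction_seed_sample (R : realType) (d : nat)
    (dT dW : measure_display) (T : measurableType dT) (W : measurableType dW)
    (P : probability T R) (Q : probability W R) (m : nat)
    (z : 'I_m -> {RV P >-> borel_rV R d}) (w : 'I_m -> {RV P >-> W}) :
    Prop := {
  directions_uniform : forall i, uniform_on_sphere (distribution P (z i)) ;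
  seeds_law : forall i (A : set W), measurable A ->
    distribution P (w i) A = Q A ;
  directions_seeds_independent : mutually_independent P
    (fun k : 'I_m + 'I_m =>
       match k with inl i => events_of (z i) | inr i => events_of (w i) end) }.

Definition one_bit_feasible (R : realType) (d : nat) (s : R) :
    set 'rV[R]_d :=
  [set g | l1norm g <= Num.sqrt s /\ l2norm g <= 1].

Definition one_bit_objective (R : realType) (d m : nat) (z : 'I_m -> 'rV[R]_d)
    (y : 'I_m -> R) (g : 'rV[R]_d) : R :=
  \sum_(i < m) y i * dotp (z i) g.

(* ghat is an output of 1BitGradEst(x, s, m, r) when the directions drawn are
   z_1, ..., z_m and the oracle seeds of the successive queries are
   w_1, ..., w_m. *)
Definition one_bit_grad_est (R : realType) (d : nat) (W : Type)
    (oracle : W -> 'rV[R]_d -> 'rV[R]_d -> R) (x : 'rV[R]_d) (s : R) (m : nat)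
    (r : R) (z : 'I_m -> 'rV[R]_d) (w : 'I_m -> W) (ghat : 'rV[R]_d) : Prop :=
  let y := fun i => oracle (w i) x (x + r *: z i) in
  one_bit_feasible s ghat /\
  forall g', one_bit_feasible s g' ->
    one_bit_objective z y g' <= one_bit_objective z y ghat.

(* For a measurable S this says P S >= p.  The inner formulation avoids having
   to assume that the selection of a maximizer in [one_bit_grad_est], which
   need not be unique, depends measurably on the sample. *)
Definition with_probability_at_least (R : realType) (dT : measure_display)
    (T : measurableType dT) (P : probability T R) (p : R) (S : set T) : Prop :=
  exists E : set T, [/\ measurable E, E `<=` S & (p%:E <= P E)%E].

(* Main.v *)
Require Import Defs.
From HB Require Import structures.
From mathcomp Require Import all_boot all_order all_algebra.
From mathcomp Require Import all_classical all_reals all_analysis measurable_realfun.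
From mathcomp Require Import finmap ring lra.
Set Implicit Arguments.
Unset Strict Implicit.
Unset Printing Implicit Defensive.
Import Order.TTheory GRing.Theory Num.Theory.
Import numFieldNormedType.Exports.
Local Open Scope classical_set_scope.
Local Open Scope ring_scope.

(** Write z for a uniform direction, gb for the normalized gradient at x, and
    zeta(z) for the sign of f(x + r z) - f(x). The algorithm maximizes u -> M.u
    over a set that contains gb, where M is the sum of the vectors y_i z_i. So
    it suffices that the mean of M points almost along gb and that M deviates
    little from its mean, uniformly over the feasible set.

    Mean. Given z, the answer y has mean (2p - 1) zeta(z) with 2p - 1 >= 2 delta0,
    so the mean of y z is (2p - 1) e with e = E[zeta(z) z]. The radius r does not
    tend to 0, hence zeta(z) is not the sign of z.gb, and e need not be parallel
    to gb. But E |f(x + r z) - f(x)| is invariant under rotations of z, and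
    |F| >= zeta F for every F; comparing z with its mirror image under the
    reflection that exchanges gb with a unit vector u gives
    e.u <= e.gb + 2/d (comparison_maximizer). Convexity and smoothness give
    e.gb >= c0 / sqrt d (comparison_drift). Taking u along e, the angle between e
    and gb is of order d^(-1/4). This is below eta, because the claimed
    probability is nonpositive unless eta^4 s log(2d/s) is large, and
    s log(2d/s) <= 2d; then every feasible u at distance more than eta from gb
    has e.(u - gb) <= - |e| eta^2 / 16 (nearly_aligned_gap).

    Deviation. The only information on the uniform law is its invariance under
    orthogonal maps. Rotating n to a multiple of (1, ..., 1) and averaging over
    sign changes of the coordinates gives E exp(z.n) <= exp(2 |n|^2 / d)
    (mgf_uniform_direction). This passes to the centered answers, and by
    independence to V = M - E M: E exp(V.n) <= exp(4 m |n|^2 / d)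
    (deviation_mgf). A union bound over integer points n, followed by rounding of
    sqrt s * u to an integer point, bounds V.u on the whole feasible set by a
    multiple of sqrt(m s log(2d/s) / d) (subgaussian_feasible_le). With the
    prescribed m this is smaller than the gap left by the mean. *)

(** * Exponential bounds for the hyperbolic cosine *)

Definition coshR {R : realType} (t : R) : R := (expR t + expR (- t)) / 2.

Lemma coshRE (R : realType) (t : R) : expR t + expR (- t) = 2 * coshR t.
Proof. by rewrite /coshR; field. Qed.

Lemma coshRN (R : realType) (t : R) : coshR (- t) = coshR t.
Proof. by rewrite /coshR opprK addrC. Qed.

Lemma coshR_gt0 (R : realType) (t : R) : 0 < coshR t.
Proof. by rewrite divr_gt0 // addr_gt0 // expR_gt0. Qed.

Lemma coshR_double (R : realType) (t : R) :
  coshR t = 2 * coshR (t / 2) ^+ 2 - 1.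
Proof.
have h : expR (t / 2) * expR (- (t / 2)) = 1 by rewrite -expRD subrr expR0.
have e1 : expR t = expR (t / 2) ^+ 2.
  by rewrite expr2 -expRD; congr expR; field.
have e2 : expR (- t) = expR (- (t / 2)) ^+ 2.
  by rewrite expr2 -expRD; congr expR; field.
rewrite /coshR e1 e2.
set a := expR (t / 2) in h *; set b := expR (- (t / 2)) in h *.
have -> : 2 * ((a + b) / 2) ^+ 2 - 1 = (a ^+ 2 + b ^+ 2) / 2 + (a * b - 1).
  by field.
by rewrite h subrr addr0.
Qed.

Lemma coshR_le_small (R : realType) (t : R) :
  `|t| <= 2^-1 -> coshR t <= expR (2 * t ^+ 2).
Proof.
rewrite ler_norml => /andP[t1 t2].
have inv (u : R) : - 2^-1 <= u -> u <= 2^-1 -> expR u <= (1 - u)^-1.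
  move=> u1 u2; rewrite -[u in expR u]opprK expRN lef_pV2 ?posrE ?expR_gt0 //.
    exact: expR_ge1Dx.
  lra.
have h1 := inv t t1 t2.
have h2 : expR (- t) <= (1 + t)^-1.
  by rewrite -[t in (1 + t)]opprK; apply: inv; lra.
apply: le_trans (expR_ge1Dx _).
have p1 : 0 < 1 - t by lra.
have p2 : 0 < 1 + t by lra.
have p3 : 0 < 1 - t ^+ 2.
  by rewrite (_ : 1 - t ^+ 2 = (1 - t) * (1 + t)) ?mulr_gt0 //; ring.
have ht : coshR t <= ((1 - t)^-1 + (1 + t)^-1) / 2.
  by rewrite ler_pM2r ?invr_gt0 // lerD.
apply: (le_trans ht).
have -> : ((1 - t)^-1 + (1 + t)^-1) / 2 = (1 - t ^+ 2)^-1.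
  by field; rewrite !lt0r_neq0.
rewrite -(ler_pM2r p3) mulVf ?lt0r_neq0 //.
have : t ^+ 2 <= 4^-1 by nra.
have : 0 <= t ^+ 2 by exact: sqr_ge0.
by move: (t ^+ 2) => q q0 q1; nra.
Qed.

(** Doubling turns the bound near 0 into a global one: cosh t = 2 c^2 - 1 is at
    most c^4 for c = cosh (t / 2), because c^4 - 2 c^2 + 1 is a square. *)
Lemma coshR_le (R : realType) (t : R) : coshR t <= expR (2 * t ^+ 2).
Proof.
have H n : forall u : R, `|u| <= 2 ^+ n / 2 -> coshR u <= expR (2 * u ^+ 2).
  elim: n => [|n IH] u hu.
    by apply: coshR_le_small; rewrite expr0 mul1r in hu.
  have hu2 : `|u / 2| <= 2 ^+ n / 2.
    rewrite normrM (@ger0_norm _ (2^-1)) ?invr_ge0 // ler_pM2r ?invr_gt0 //.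
    by move: hu; rewrite exprSr mulfK.
  have {}IH := IH _ hu2.
  rewrite coshR_double.
  have -> : 2 * u ^+ 2 = 2 * (u / 2) ^+ 2 * 4%:R by field.
  rewrite expRM_natr.
  apply: (@le_trans _ _ (coshR (u / 2) ^+ 4)).
    have := sqr_ge0 (coshR (u / 2) ^+ 2 - 1).
    by rewrite sqrrB1 -exprM mulr_natl; lra.
  by rewrite lerXn2r // nnegrE ltW // ?coshR_gt0 ?expR_gt0.
have [n hn] : exists n, `|t| <= 2 ^+ n / 2.
  pose k := Num.bound (`|t|).
  exists k.+1; rewrite exprSr mulfK //.
  apply: le_trans (ltW (archi_boundP (normr_ge0 t))) _.
  by rewrite -natrX ler_nat ltnW // ltn_expl.
exact: H hn.
Qed.

(** Turns a bound on an exponential moment into one on the fourth moment. *)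
Lemma quartic_le_coshR (R : realType) (t : R) : t ^+ 4 <= 2 * 4 ^+ 4 * coshR t.
Proof.
wlog t0 : t / 0 <= t.
  move=> H; case: (leP 0 t) => [|/ltW] h; first exact: H.
  have -> : t ^+ 4 = (- t) ^+ 4 by ring.
  by rewrite -coshRN; apply: H; lra.
have h1 : t / 4 <= expR (t / 4) by have := expR_ge1Dx (t / 4); lra.
have h2 : t ^+ 4 <= 4 ^+ 4 * expR t.
  have -> : expR t = expR (t / 4) ^+ 4.
    by rewrite -expRM_natr; congr expR; field.
  by rewrite -exprMn lerXn2r ?nnegrE ?mulr_ge0 ?expR_ge0 //; lra.
rewrite -mulrA mulrCA -coshRE; apply: (le_trans h2).
by rewrite ler_wpM2l ?exprn_ge0 // lerDl expR_ge0.
Qed.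

(** * Euclidean geometry of row vectors *)

Section euclid.
Context {R : realType} {d : nat}.
Implicit Types u v w : 'rV[R]_d.

Lemma dotpC u v : dotp u v = dotp v u.
Proof. by apply: eq_bigr => i _; rewrite mulrC. Qed.

Lemma dotpDl u v w : dotp (u + v) w = dotp u w + dotp v w.
Proof. by rewrite -big_split; apply: eq_bigr => i _; rewrite mxE mulrDl. Qed.

Lemma dotpZl (a : R) u w : dotp (a *: u) w = a * dotp u w.
Proof. by rewrite mulr_sumr; apply: eq_bigr => i _; rewrite mxE mulrA. Qed.

Lemma dotpNl u w : dotp (- u) w = - dotp u w.
Proof. by rewrite -scaleN1r dotpZl mulN1r. Qed.

Lemma dotpBl u v w : dotp (u - v) w = dotp u w - dotp v w.
Proof. by rewrite dotpDl dotpNl. Qed.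

Lemma dotpDr u v w : dotp w (u + v) = dotp w u + dotp w v.
Proof. by rewrite !(dotpC w) dotpDl. Qed.

Lemma dotpZr (a : R) u w : dotp w (a *: u) = a * dotp w u.
Proof. by rewrite !(dotpC w) dotpZl. Qed.

Lemma dotpNr u w : dotp w (- u) = - dotp w u.
Proof. by rewrite !(dotpC w) dotpNl. Qed.

Lemma dotpBr u v w : dotp w (u - v) = dotp w u - dotp w v.
Proof. by rewrite !(dotpC w) dotpBl. Qed.

Lemma dotp0r w : dotp w 0 = 0.
Proof. by rewrite -(scale0r 0) dotpZr mul0r. Qed.

Lemma dotp_suml (I : Type) (s : seq I) (F : I -> 'rV[R]_d) w :
  dotp (\sum_(i <- s) F i) w = \sum_(i <- s) dotp (F i) w.
Proof.
by elim/big_rec2: _ => [|i x y _ <-]; rewrite ?dotpDl // dotpC dotp0r.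
Qed.

Lemma dotpuu_ge0 u : 0 <= dotp u u.
Proof. by apply: sumr_ge0 => i _; rewrite -expr2 sqr_ge0. Qed.

Lemma dotpuu_eq0 u : dotp u u = 0 -> u = 0.
Proof.
move=> h; apply/rowP => i; rewrite mxE; apply/eqP.
rewrite -sqrf_eq0 expr2; apply/eqP.
by apply: (psumr_eq0P _ h) => // j _; rewrite -expr2 sqr_ge0.
Qed.

Lemma l2norm_sqr u : l2norm u ^+ 2 = dotp u u.
Proof.
rewrite sqr_sqrtr; last by apply: sumr_ge0 => i _; exact: sqr_ge0.
by apply: eq_bigr => i _; rewrite expr2.
Qed.

Lemma l2norm_ge0 u : 0 <= l2norm u. Proof. exact: sqrtr_ge0. Qed.

Lemma l2normE u : l2norm u = Num.sqrt (dotp u u).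
Proof. by rewrite -l2norm_sqr sqrtr_sqr ger0_norm ?l2norm_ge0. Qed.

Lemma l2normZ (a : R) u : l2norm (a *: u) = `|a| * l2norm u.
Proof.
by rewrite !l2normE dotpZl dotpZr mulrA -expr2 sqrtrM ?sqr_ge0 // sqrtr_sqr.
Qed.

Lemma l2normN u : l2norm (- u) = l2norm u.
Proof. by rewrite !l2normE dotpNl dotpNr opprK. Qed.

Lemma l2norm0 : l2norm (0 : 'rV[R]_d) = 0.
Proof. by rewrite -(scale0r 0) l2normZ normr0 mul0r. Qed.

Lemma l2norm_eq0 u : l2norm u = 0 -> u = 0.
Proof. by move=> h; apply: dotpuu_eq0; rewrite -l2norm_sqr h expr0n. Qed.

Lemma CauchySchwarz_dotp u v : dotp u v <= l2norm u * l2norm v.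
Proof.
have [/l2norm_eq0 ->|nv] := eqVneq (l2norm v) 0.
  by rewrite dotp0r mulr_ge0 // l2norm_ge0.
have [/l2norm_eq0 ->|nu] := eqVneq (l2norm u) 0.
  by rewrite dotpC dotp0r mulr_ge0 // l2norm_ge0.
have pv : 0 < l2norm v by rewrite lt_neqAle eq_sym nv l2norm_ge0.
have pu : 0 < l2norm u by rewrite lt_neqAle eq_sym nu l2norm_ge0.
have := dotpuu_ge0 (l2norm v *: u - l2norm u *: v).
rewrite !(dotpBl, dotpBr, dotpZl, dotpZr) -!l2norm_sqr (dotpC v u).
have p : 0 < l2norm u * l2norm v by rewrite mulr_gt0.
move: (l2norm u) (l2norm v) (dotp u v) pu pv p => a b c pa pb p h.
rewrite -(ler_pM2l p); nra.
Qed.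

Lemma ler_norm_dotp u v : `|dotp u v| <= l2norm u * l2norm v.
Proof.
rewrite ler_norml CauchySchwarz_dotp andbT lerNl -dotpNl -(l2normN u).
exact: CauchySchwarz_dotp.
Qed.

Lemma l2normB_sqr u v :
  l2norm (u - v) ^+ 2 = l2norm u ^+ 2 - 2 * dotp u v + l2norm v ^+ 2.
Proof. by rewrite !l2norm_sqr !(dotpBl, dotpBr) (dotpC v u); ring. Qed.

Lemma ler_l2normD u v : l2norm (u + v) <= l2norm u + l2norm v.
Proof.
rewrite -(@ler_pXn2r _ 2) ?nnegrE ?addr_ge0 ?l2norm_ge0 //.
have -> : l2norm (u + v) ^+ 2 = l2norm u ^+ 2 + 2 * dotp u v + l2norm v ^+ 2.
  by rewrite -[v in u + v]opprK l2normB_sqr dotpNr l2normN; ring.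
have := CauchySchwarz_dotp u v; rewrite sqrrD; lra.
Qed.

Lemma ler_l2norm_coord u i : `|u ord0 i| <= l2norm u.
Proof.
rewrite -sqrtr_sqr ler_wsqrtr // (bigD1 i) //= lerDl.
by apply: sumr_ge0 => j _; rewrite sqr_ge0.
Qed.

(** The Householder reflection in the hyperplane orthogonal to [n]; it is the
    identity when [n = 0], as division by 0 yields 0. *)
Definition reflection n : 'M[R]_d := 1%:M - (2 / dotp n n) *: (n^T *m n).

Lemma mul_reflection u n :
  u *m reflection n = u - (2 * dotp u n / dotp n n) *: n.
Proof.
have e : u *m n^T = (dotp u n)%:M.
  apply/matrixP => i j; rewrite !ord1 !mxE eqxx mulr1n.
  by apply: eq_bigr => k _; rewrite mxE.
rewrite mulmxBr mulmx1 -scalemxAr mulmxA e mul_scalar_mx scalerA.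
by rewrite mulrAC.
Qed.

Lemma reflection_tr n : (reflection n)^T = reflection n.
Proof. by rewrite linearB /= trmx1 linearZ /= trmx_mul trmxK. Qed.

Lemma reflectionK n : reflection n *m reflection n = 1%:M.
Proof.
suff H u : u *m reflection n *m reflection n = u.
  by apply/row_matrixP => i; rewrite row_mul [row i (reflection n)]rowE H rowE mulmx1.
have [->|n0] := eqVneq n 0.
  by rewrite !mul_reflection !scaler0 !subr0.
have nn : dotp n n != 0 by apply: contra_neq n0; exact: dotpuu_eq0.
rewrite !mul_reflection dotpBl dotpZl -addrA -opprD -scalerDl.
set c := (X in u - X *: n); suff -> : c = 0 by rewrite scale0r subr0.
by rewrite /c; field.
Qed.

Lemma reflection_orthogonal n : reflection n *m (reflection n)^T = 1%:M.
Proof. by rewrite reflection_tr reflectionK. Qed.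

Lemma dotp_mul_tr u v (O : 'M[R]_d) : dotp (u *m O) v = dotp u (v *m O^T).
Proof.
have E (a b : 'rV[R]_d) : dotp a b = (a *m b^T) ord0 ord0.
  by rewrite !mxE; apply: eq_bigr => i _; rewrite mxE.
by rewrite !E trmx_mul trmxK mulmxA.
Qed.

Lemma dotp_mul_orthogonal u v (O : 'M[R]_d) :
  O *m O^T = 1%:M -> dotp (u *m O) (v *m O) = dotp u v.
Proof. by move=> h; rewrite dotp_mul_tr -mulmxA h mulmx1. Qed.

Lemma l2norm_mul_orthogonal u (O : 'M[R]_d) :
  O *m O^T = 1%:M -> l2norm (u *m O) = l2norm u.
Proof. by move=> h; rewrite !l2normE dotp_mul_orthogonal. Qed.

(** As the lengths agree, [u - v] is normal to the hyperplane that bisects the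
    angle of [u] and [v]. *)
Lemma reflection_swap u v :
  l2norm u = l2norm v -> u *m reflection (u - v) = v.
Proof.
move=> h; have e : dotp u u = dotp v v by rewrite -!l2norm_sqr h.
have [uv|n0] := eqVneq (u - v) 0.
  rewrite uv mul_reflection scaler0 subr0; exact/subr0_eq.
have nn : dotp (u - v) (u - v) != 0 by apply: contra_neq n0; exact: dotpuu_eq0.
rewrite mul_reflection (_ : _ / _ = 1) ?scale1r ?subKr //.
apply: (mulIf nn); rewrite divfK // mul1r.
by rewrite !(dotpBl, dotpBr) (dotpC v u) e; ring.
Qed.

Lemma dotp_reflection_swap z u v : l2norm u = l2norm v ->
  dotp (z *m reflection (u - v)) u = dotp z v.
Proof. by move=> h; rewrite dotp_mul_tr reflection_tr reflection_swap. Qed.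

End euclid.

(** * First-order bounds for smooth convex functions *)

Section first_order.
Context {R : realType} {d : nat}.
Implicit Types (f : 'rV[R]_d -> R) (x v z : 'rV[R]_d).

Lemma derive_gradient f x v :
  differentiable f x -> 'D_v f x = dotp (gradient f x) v.
Proof.
move=> df; rewrite deriveE // [v in LHS]row_sum_delta linear_sum.
apply: eq_bigr => i _; rewrite linearZ /= mxE deriveE //.
by rewrite mulrC; congr (_ * _).
Qed.

Lemma is_derive_line f x v (t : R) : differentiable f (x + t *: v) ->
  is_derive t 1 (fun u : R => f (x + u *: v)) (dotp (gradient f (x + t *: v)) v).
Proof.
move=> df; rewrite -derive_gradient //.
set y := x + t *: v.
have E : (fun h : R => h^-1 *: ((fun u : R => f (x + u *: v)) (h *: 1 + t)
            - (fun u : R => f (x + u *: v)) t)) =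
         (fun h : R => h^-1 *: (f (h *: v + y) - f y)).
  apply/funext => h; congr (_ *: (f _ - _)).
  by rewrite /y /GRing.scale /= mulr1 -!/(GRing.scale _ _) scalerDl addrCA addrA.
split; first by rewrite /derivable E; exact: diff_derivable.
by rewrite /derive E.
Qed.

Lemma MVT_gradient f x v : (forall y, differentiable f y) ->
  exists2 t : R, 0 < t < 1 &
    f (x + v) - f x = dotp (gradient f (x + t *: v)) v.
Proof.
move=> df; pose phi (t : R) := f (x + t *: v).
have dphi (t : R) : is_derive t 1 phi (dotp (gradient f (x + t *: v)) v).
  exact/is_derive_line/df.
have cphi : {within `[0, 1], continuous phi}.
  apply: derivable_within_continuous => t _.
  by have [] := dphi t.
have [t] := MVT ltr01 (fun t _ => dphi t) cphi.
rewrite in_itv /= subr0 mulr1 => t01 e; exists t => //.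
by rewrite -e /phi scale1r scale0r addr0.
Qed.

(** The mean value theorem on the segment from [x + u] to [x + v], which stays in
    the ball of radius [rho] around [x]: there the gradient differs from the one
    at [x] by at most [L * rho]. *)
Lemma lipschitz_gradient_remainder f x (L rho : R) u v :
    (forall y, differentiable f y) -> 0 <= L ->
    (forall y z, l2norm (gradient f y - gradient f z) <= L * l2norm (y - z)) ->
    l2norm u <= rho -> l2norm v <= rho ->
  `|f (x + v) - f (x + u) - dotp (gradient f x) (v - u)|
    <= L * rho * l2norm (v - u).
Proof.
move=> df L0 Lf u1 v1.
have [t /andP[t0 t1]] := MVT_gradient (x + u) (v - u) df.
rewrite -addrA (addrC u) subrK => ->.
rewrite -dotpBl; apply: (le_trans (ler_norm_dotp _ _)).
rewrite ler_wpM2r ?l2norm_ge0 //.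
apply: (le_trans (Lf _ _)); rewrite ler_wpM2l //.
have -> : x + u + t *: (v - u) - x = (1 - t) *: u + t *: v.
  rewrite addrAC (addrAC x) subrr add0r scalerBl scale1r scalerBr.
  by rewrite addrA addrAC.
apply: (le_trans (ler_l2normD _ _)); rewrite !l2normZ.
rewrite (@ger0_norm _ (1 - t)) ?(@ger0_norm _ t) ?subr_ge0; try exact: ltW.
rewrite [leRHS](_ : rho = (1 - t) * rho + t * rho); last by ring.
by rewrite lerD // ler_wpM2l ?subr_ge0 //; exact: ltW.
Qed.

(** Two steps of half the length, with gradient errors at most [L rho] and
    [L rho / 2]; the constant 3/4 must be below 1, as it is compared with the
    standard deviation of a normalized coordinate of a random direction. *)
Lemma lipschitz_gradient_upper f x (L rho : R) v :
    (forall y, differentiable f y) -> 0 <= L ->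
    (forall y z, l2norm (gradient f y - gradient f z) <= L * l2norm (y - z)) ->
    l2norm v <= rho ->
  f (x + v) - f x <= dotp (gradient f x) v + 3 / 4 * L * rho ^+ 2.
Proof.
move=> df L0 Lf v1.
have r0 : 0 <= rho by apply: le_trans v1; exact: l2norm_ge0.
have hh : l2norm (2^-1 *: v) <= rho / 2.
  by rewrite l2normZ ger0_norm ?invr_ge0 // mulrC ler_wpM2r // invr_ge0.
have hv : v - 2^-1 *: v = 2^-1 *: v.
  by rewrite -[v in v - _]scale1r -scalerBl; congr (_ *: _); field.
have h0 : l2norm (0 : 'rV[R]_d) <= rho / 2.
  by rewrite l2norm0 divr_ge0.
have hm : l2norm (2^-1 *: v) <= rho by apply: (le_trans hh); lra.
have A := lipschitz_gradient_remainder x df L0 Lf hm v1.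
have B := lipschitz_gradient_remainder x df L0 Lf h0 hh.
rewrite hv in A; rewrite addr0 subr0 in B.
move: A B; rewrite !ler_norml dotpZr => /andP[_ A] /andP[_ B].
have C1 : L * rho * l2norm (2^-1 *: v) <= L * rho * (rho / 2).
  by rewrite ler_wpM2l // mulr_ge0.
have C2 : L * (rho / 2) * l2norm (2^-1 *: v) <= L * (rho / 2) * (rho / 2).
  by rewrite ler_wpM2l // mulr_ge0 // divr_ge0.
have := le_trans A C1; have := le_trans B C2.
by rewrite expr2; lra.
Qed.

(** On the segment from [x] to [x + v] the chord lies above f, and the error of
    the linear approximation is quadratic in the position t; compare both as t
    tends to 0. *)
Lemma convex_gradient_lower f x (L : R) v :
    (forall y, differentiable f y) -> 0 <= L ->
    (forall y z, l2norm (gradient f y - gradient f z) <= L * l2norm (y - z)) ->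
    convex_function [set: 'rV[R]_d] f ->
  dotp (gradient f x) v <= f (x + v) - f x.
Proof.
move=> df L0 Lf cf.
have H (t : R) : 0 < t -> t <= 1 ->
    dotp (gradient f x) v - L * l2norm v ^+ 2 * t <= f (x + v) - f x.
  move=> t0 t1; rewrite -(ler_pM2l t0).
  have tl : l2norm (t *: v) <= t * l2norm v.
    by rewrite l2normZ ger0_norm; [exact: lexx|exact: ltW].
  have h0 : l2norm (0 : 'rV[R]_d) <= t * l2norm v.
    by rewrite l2norm0; exact: le_trans (l2norm_ge0 _) tl.
  have := lipschitz_gradient_remainder x df L0 Lf h0 tl.
  rewrite addr0 subr0 ler_norml dotpZr => /andP[A _].
  have B : f (x + t *: v) - f x <= t * (f (x + v) - f x).
    pose p : {i01 R} := @Itv01 R t (ltW t0) t1.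
    have := cf p (x + v) x; rewrite !in_setT => /(_ isT isT).
    have -> : conv p (f (x + v) : R^o) (f x : R^o)
              = t * f (x + v) + (1 - t) * f x by [].
    rewrite /conv /= /unstable.onem.
    have -> : t *: (x + v) + (1 - t) *: x = x + t *: v.
      by rewrite scalerDr addrAC -scalerDl addrC [t + _]addrC subrK scale1r addrC.
    move=> h.
    by apply: le_trans (lerB h (lexx (f x))) _; lra.
  have C : L * (t * l2norm v) * l2norm (t *: v) <= L * (t * l2norm v) * (t * l2norm v).
    by rewrite ler_wpM2l // mulr_ge0 //; exact: le_trans (l2norm_ge0 _) tl.
  nra.
rewrite leNgt; apply/negP; rewrite -subr_gt0; set D := (X in 0 < X) => D0.
have K0 : 0 <= L * l2norm v ^+ 2 by rewrite mulr_ge0 // sqr_ge0.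
pose K := L * l2norm v ^+ 2 + D + 1.
have Kp : 0 < K by rewrite /K; lra.
have := H (D / K) (divr_gt0 D0 Kp).
rewrite ler_pdivrMr // mul1r.
have -> : D <= K by rewrite /K; lra.
move=> /(_ isT); rewrite leNgt => /negP; apply.
rewrite -subr_gt0 (_ : _ - _ = D - L * l2norm v ^+ 2 * (D / K)); last by rewrite /D; ring.
rewrite subr_gt0 mulrCA gtr_pMr // ltr_pdivrMr // mul1r /K; lra.
Qed.

End first_order.

(** * Measurability on the Borel space of row vectors *)

Section borel.
Context {R : realType} {d : nat}.

Lemma continuous_measurable_borel (f : 'rV[R]_d -> R) :
  continuous f -> measurable_fun [set: borel_rV R d] f.
Proof.
move=> cf; apply: (measurability _ (RGenOpens.measurableE R)).
move=> _ [_ [a [b ->] <-]]; rewrite setTI; apply: sub_sigma_algebra.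
by move/continuousP : cf; apply; exact: interval_open.
Qed.

Lemma continuous_measurable_borel_rV (g : 'rV[R]_d -> 'rV[R]_d) :
  continuous g -> measurable_fun [set: borel_rV R d] (g : _ -> borel_rV R d).
Proof.
move=> cg; apply: (@measurability _ _ (borel_rV R d) (borel_rV R d) setT g (@open 'rV[R]_d)) => //.
move=> _ [A oA <-]; rewrite setTI; apply: sub_sigma_algebra.
by move/continuousP : cg; apply.
Qed.

Lemma continuous_rV (g : 'rV[R]_d -> 'rV[R]_d) :
  (forall i, continuous (fun v => g v ord0 i)) -> continuous g.
Proof.
move=> cg x A /nbhs_ballP[e /= e0 eA].
have H : nbhs x [set t | forall i, ball (g x ord0 i) e (g t ord0 i)].
  apply: (@filter_forall _ 'I_d _ _ (nbhs_filter x)) => i.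
  exact: (cg i x _ (nbhsx_ballx _ _ e0)).
apply: filterS H => t Ht; apply: eA; split => // i j.
by rewrite ord1; exact: Ht.
Qed.

Lemma continuous_sum (I : Type) (s : seq I) (F : I -> 'rV[R]_d -> R) :
  (forall i, continuous (F i)) -> continuous (fun v => \sum_(i <- s) F i v).
Proof.
move=> cF; elim: s => [|i s IH].
  rewrite (_ : (fun v => _) = cst 0); first exact: cst_continuous.
  by apply/funext => v; rewrite big_nil.
rewrite (_ : (fun v => _) = fun v => F i v + \sum_(j <- s) F j v).
  by move=> x; exact: (cvgD (cF i x) (IH x)).
by apply/funext => v; rewrite big_cons.
Qed.

Lemma continuous_dotp (n : 'rV[R]_d) : continuous (fun v => dotp v n).
Proof.
apply: continuous_sum => i x.
exact: (cvgM (@coord_continuous _ _ _ ord0 i x) (cvg_cst _)).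
Qed.

Lemma continuous_mulmx (O : 'M[R]_d) : continuous (fun v : 'rV[R]_d => v *m O).
Proof.
apply: continuous_rV => i; under eq_fun do rewrite mxE.
apply: continuous_sum => k x.
exact: (cvgM (@coord_continuous _ _ _ ord0 k x) (cvg_cst _)).
Qed.

Lemma continuous_l2norm : continuous (@l2norm R d).
Proof.
have c : continuous (fun v : 'rV[R]_d => dotp v v).
  apply: continuous_sum => i y.
  exact: (cvgM (@coord_continuous _ _ _ ord0 i y) (@coord_continuous _ _ _ ord0 i y)).
rewrite (_ : @l2norm R d = Num.sqrt \o (fun v => dotp v v)).
  by move=> x; exact: (continuous_comp (c x) (@sqrt_continuous R _)).
by apply/funext => v; rewrite l2normE.
Qed.

Lemma measurable_dotp (n : 'rV[R]_d) :
  measurable_fun [set: borel_rV R d] (fun v : borel_rV R d => dotp v n).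
Proof. exact: (continuous_measurable_borel (continuous_dotp (n := n))). Qed.

Lemma measurable_mulmx (O : 'M[R]_d) :
  measurable_fun [set: borel_rV R d] (fun v : borel_rV R d => (v *m O : borel_rV R d)).
Proof. exact: (continuous_measurable_borel_rV (continuous_mulmx (O := O))). Qed.

Lemma measurable_ray (x : 'rV[R]_d) (r : R) :
  measurable_fun [set: borel_rV R d]
    (fun v : borel_rV R d => (x + r *: (v : 'rV[R]_d) : borel_rV R d)).
Proof.
apply: continuous_measurable_borel_rV; apply: continuous_rV => i.
under eq_fun do rewrite !mxE; move=> y.
exact: (cvgD (cvg_cst _) (cvgM (cvg_cst _) (@coord_continuous _ _ _ ord0 i y))).
Qed.

Definition sphere : set (borel_rV R d) := [set v : 'rV[R]_d | l2norm v = 1].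

Lemma measurable_sphere : measurable sphere.
Proof.
have := continuous_measurable_borel continuous_l2norm.
move=> /(_ measurableT [set 1] (measurable_set1 _)); rewrite setTI.
by apply.
Qed.

End borel.

(** * Means of bounded functions *)

(** Boundedness is only asked on [D], which will be a set of full measure such
    as the unit sphere inside the space of all row vectors. *)
Definition bounded_measurable {R : realType} {dU} {U : measurableType dU}
    (D : set U) (f : U -> R) : Prop :=
  measurable_fun [set: U] f /\ exists K, forall x, D x -> `|f x| <= K.

Definition mean {R : realType} {dU} {U : measurableType dU}
    (mu : probability U R) (D : set U) (f : U -> R) : R :=
  \int[mu]_(x in D) f x.

Section mean.
Context {R : realType} {dU : measure_display} {U : measurableType dU}.
Variables (mu : probability U R) (D : set U).
Implicit Types f g : U -> R.
Notation bm := (bounded_measurable D).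

Lemma bm_cst (c : R) : bm (fun _ => c).
Proof. by split; [exact: measurable_cst | exists `|c|]. Qed.

Lemma bmD f g : bm f -> bm g -> bm (fun x => f x + g x).
Proof.
move=> [mf [K hK]] [mg [M hM]]; split; first exact: measurable_funD.
exists (K + M) => x Dx; apply: (le_trans (ler_normD _ _)).
by apply: lerD; [exact: hK | exact: hM].
Qed.

Lemma bmM f g : bm f -> bm g -> bm (fun x => f x * g x).
Proof.
move=> [mf [K hK]] [mg [M hM]]; split; first exact: measurable_funM.
by exists (K * M) => x Dx; rewrite normrM ler_pM ?hK ?hM.
Qed.

Lemma bmZ c f : bm f -> bm (fun x => c * f x).
Proof. by apply: bmM; exact: bm_cst. Qed.

Lemma bmN f : bm f -> bm (fun x => - f x).
Proof.
by move=> /(bmZ (-1)); under [X in _ -> bm X]eq_fun do rewrite -mulN1r.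
Qed.

Lemma bmB f g : bm f -> bm g -> bm (fun x => f x - g x).
Proof. by move=> bf bg; apply: bmD => //; exact: bmN. Qed.

Lemma bmX f k : bm f -> bm (fun x => f x ^+ k).
Proof.
move=> bf; elim: k => [|k IH]; first exact: bm_cst.
by under eq_fun do rewrite exprS; exact: bmM.
Qed.

Lemma bm_norm f : bm f -> bm (fun x => `|f x|).
Proof.
move=> [mf [K hK]]; split; first exact: measurableT_comp.
by exists K => x Dx; rewrite normr_id hK.
Qed.

Lemma bm_expR f : bm f -> bm (fun x => expR (f x)).
Proof.
move=> [mf [K hK]]; split; first exact: measurableT_comp.
exists (expR K) => x Dx; rewrite ger0_norm ?expR_ge0 // ler_expR.
exact: le_trans (ler_norm _) (hK x Dx).
Qed.

Lemma bm_sum (I : Type) (s : seq I) (F : I -> U -> R) :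
  (forall i, bm (F i)) -> bm (fun x => \sum_(i <- s) F i x).
Proof.
move=> bF; elim: s => [|i s IH].
  by under eq_fun do rewrite big_nil; exact: bm_cst.
by under eq_fun do rewrite big_cons; exact: bmD.
Qed.

Lemma bm_coshR f : bm f -> bm (fun x => coshR (f x)).
Proof.
move=> bf; rewrite /coshR; apply: bmM; last exact: bm_cst.
by apply: bmD; apply: bm_expR => //; exact: bmN.
Qed.

Hypotheses (mD : measurable D) (D1 : mu D = 1%E).

Lemma bm_integrable f : bm f -> mu.-integrable D (EFin \o f).
Proof.
move=> [mf [K hK]]; apply: measurable_bounded_integrable => //.
- by apply: (le_lt_trans (probability_le1 mu mD)); rewrite ltry.
- exact: measurable_funTS.
- exists K; split; first exact: num_real.
  by move=> M KM x Dx; exact: le_trans (hK x Dx) (ltW KM).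
Qed.

Lemma mean_EFin f : bm f -> (\int[mu]_(x in D) (f x)%:E = (mean mu D f)%:E)%E.
Proof.
by move=> bf; rewrite /mean fineK //; exact: integrable_fin_num (bm_integrable bf).
Qed.

Lemma mean_cst (c : R) : mean mu D (fun _ => c) = c.
Proof.
rewrite /mean Rintegral_cst //.
by apply: (etrans (congr1 (fun e => c * fine e) D1)); rewrite mulr1.
Qed.

Lemma meanD f g : bm f -> bm g ->
  mean mu D (fun x => f x + g x) = mean mu D f + mean mu D g.
Proof. by move=> bf bg; rewrite /mean RintegralD //; exact: bm_integrable. Qed.

Lemma meanB f g : bm f -> bm g ->
  mean mu D (fun x => f x - g x) = mean mu D f - mean mu D g.
Proof. by move=> bf bg; rewrite /mean RintegralB //; exact: bm_integrable. Qed.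

Lemma meanZ c f : bm f -> mean mu D (fun x => c * f x) = c * mean mu D f.
Proof. by move=> bf; rewrite /mean RintegralZl //; exact: bm_integrable. Qed.

Lemma mean_sum (I : Type) (s : seq I) (F : I -> U -> R) :
    (forall i, bm (F i)) ->
  mean mu D (fun x => \sum_(i <- s) F i x) = \sum_(i <- s) mean mu D (F i).
Proof.
move=> bF; elim: s => [|i s IH].
  by under eq_fun do rewrite big_nil; rewrite mean_cst big_nil.
under eq_fun do rewrite big_cons; rewrite meanD ?IH ?big_cons //.
exact: bm_sum.
Qed.

Lemma eq_mean f g : (forall x, D x -> f x = g x) -> mean mu D f = mean mu D g.
Proof. by move=> fg; apply: eq_Rintegral => x /set_mem; exact: fg. Qed.

Lemma le_mean f g : bm f -> bm g -> (forall x, D x -> f x <= g x) ->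
  mean mu D f <= mean mu D g.
Proof. by move=> bf bg fg; apply: le_Rintegral => //; exact: bm_integrable. Qed.

Lemma expR_mean_le f : bm f -> expR (mean mu D f) <= mean mu D (fun x => expR (f x)).
Proof.
move=> bf; set a := mean mu D f.
have -> : expR a = mean mu D (fun x => expR a * (1 + (f x - a))).
  have bd : bm (fun x => f x - a) by apply: bmB => //; exact: bm_cst.
  rewrite meanZ; last by apply: bmD => //; exact: bm_cst.
  rewrite (meanD (bm_cst 1) bd) (meanB bf (bm_cst a)) !mean_cst.
  by rewrite subrr addr0 mulr1.
apply: le_mean; [|exact: bm_expR|].
  apply: bmZ; apply: bmD; first exact: bm_cst.
  by apply: bmB => //; exact: bm_cst.
move=> x _; have -> : f x = a + (f x - a) by rewrite addrC subrK.
rewrite expRD ler_pM2l ?expR_gt0 // [a + _]addrC subrK; exact: expR_ge1Dx.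
Qed.

(** Centring costs a square: Jensen bounds exp (- E f) by E exp (- f), and with
    A = E cosh f, B = E sinh f the product (A + B) (A - B) is at most A^2. *)
Lemma centered_mgf_le f : bm f ->
  expR (- mean mu D f) * mean mu D (fun x => expR (f x))
    <= mean mu D (fun x => coshR (f x)) ^+ 2.
Proof.
move=> bf; have bNf := bmN bf; have be := bm_expR bf; have beN := bm_expR bNf.
have -> : - mean mu D f = mean mu D (fun x => - f x).
  by rewrite -mulN1r -meanZ //; apply: eq_mean => x _; rewrite mulN1r.
have h := expR_mean_le bNf.
have e0 : 0 <= mean mu D (fun x => expR (f x)).
  by rewrite /mean; apply: Rintegral_ge0 => x _; exact: expR_ge0.
apply: (le_trans (ler_wpM2r e0 h)).
have -> : mean mu D (fun x => coshR (f x)) =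
    2^-1 * (mean mu D (fun x => expR (f x)) + mean mu D (fun x => expR (- f x))).
  rewrite -meanD // -meanZ; last exact: bmD.
  by apply: eq_mean => x _; rewrite /coshR mulrC.
set a := mean mu D _; set b := mean mu D _.
have := sqr_ge0 (a - b); rewrite exprMn sqrrB sqrrD; lra.
Qed.

End mean.

(** * Uniform directions *)

Section uniform_direction.
Context {R : realType} {d : nat}.
Variable sigma : probability (borel_rV R d) R.
Hypothesis usigma : uniform_on_sphere sigma.
Notation S := (@sphere R d).
Notation bm := (bounded_measurable S).
Notation E := (mean sigma S).

Let S1 : sigma S = 1%E. Proof. by case: usigma. Qed.
Let mS : measurable S := measurable_sphere.

Lemma sphere_dotp (v : borel_rV R d) : S v -> dotp v v = 1.
Proof. by move=> Sv; rewrite -l2norm_sqr Sv expr1n. Qed.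

Lemma bm_dotp (n : 'rV[R]_d) : bm (fun v => dotp v n).
Proof.
split; first exact: measurable_dotp.
exists (l2norm n) => v Sv; apply: (le_trans (ler_norm_dotp _ _)).
by rewrite (Sv : l2norm _ = 1) mul1r.
Qed.

Lemma sphere_mul_orthogonal (O : 'M[R]_d) (v : borel_rV R d) :
  O *m O^T = 1%:M -> S (v *m O) = S v.
Proof. by move=> h; rewrite /sphere /= l2norm_mul_orthogonal. Qed.

Lemma bm_mul_orthogonal (f : borel_rV R d -> R) (O : 'M[R]_d) :
  O *m O^T = 1%:M -> bm f -> bm (fun v => f (v *m O)).
Proof.
move=> h [mf [K hK]]; split.
  by apply: (measurableT_comp mf); exact: measurable_mulmx.
by exists K => v Sv; apply: hK; rewrite sphere_mul_orthogonal.
Qed.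

Lemma mean_mul_orthogonal (f : borel_rV R d -> R) (O : 'M[R]_d) :
  O *m O^T = 1%:M -> bm f -> E (fun v => f (v *m O)) = E f.
Proof.
move=> h bf; rewrite /mean /Rintegral; congr fine.
pose phi := fun v : borel_rV R d => (v *m O : borel_rV R d).
have mphi : measurable_fun setT phi by exact: measurable_mulmx.
have pS : phi @^-1` S = S.
  by apply/funext => v; rewrite /preimage /= sphere_mul_orthogonal.
have mf : measurable_fun setT (EFin \o f) by apply/measurable_EFinP; case: bf.
have intf : sigma.-integrable (phi @^-1` S) ((EFin \o f) \o phi).
  by rewrite pS; exact: (bm_integrable sigma mS (bm_mul_orthogonal h bf)).
have e := integral_pushforward mphi mf intf mS; rewrite pS in e.
rewrite -[LHS]e; apply: eq_measure_integral => A mA _.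
exact: (proj2 usigma O h A mA).
Qed.

End uniform_direction.

Section direction_moments.
Context {R : realType} {d : nat}.
Variable sigma : probability (borel_rV R d) R.
Hypothesis usigma : uniform_on_sphere sigma.
Hypothesis d0 : (0 < d)%N.
Notation S := (@sphere R d).
Notation E := (mean sigma S).

Let S1 : sigma S = 1%E. Proof. by case: usigma. Qed.
Let mS : measurable S := measurable_sphere.
Let pd : 0 < (d%:R : R). Proof. by rewrite ltr0n. Qed.

(** Some reflection maps [u] to [v]. *)
Lemma mean_dotp_norm (h : R -> R) (u v : 'rV[R]_d) : l2norm u = l2norm v ->
    bounded_measurable S (fun z => h (dotp z u)) ->
  E (fun z => h (dotp z u)) = E (fun z => h (dotp z v)).
Proof.
move=> uv bh; rewrite -(mean_mul_orthogonal usigma (reflection_orthogonal (u - v)) bh).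
by apply: eq_mean => z _; rewrite dotp_reflection_swap.
Qed.

Definition sign_matrix (e : {ffun 'I_d -> bool}) : 'M[R]_d :=
  diag_mx (\row_i (-1) ^+ e i).

Lemma sign_matrix_orthogonal e : sign_matrix e *m (sign_matrix e)^T = 1%:M.
Proof.
rewrite /sign_matrix tr_diag_mx mulmx_diag -diag_const_mx; congr diag_mx.
by apply/rowP => i; rewrite !mxE -expr2 sqrr_sign.
Qed.

Lemma dotp_sign_matrix e (z : 'rV[R]_d) (a : R) :
  dotp (z *m sign_matrix e) (const_mx a) = \sum_i a * ((-1) ^+ e i * z ord0 i).
Proof.
apply: eq_bigr => i _; rewrite [X in X * _]mxE (bigD1 i) //= big1 ?addr0.
  by rewrite !mxE eqxx mulr1n; ring.
by move=> j ji; rewrite !mxE (negbTE ji) mulr0n mulr0.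
Qed.

(** The law of z.n only depends on the length of n, so n may be taken with
    equal coordinates. Averaging over the sign changes of the coordinates of z,
    which also preserve the law, turns the exponential of a * sum z_i into a
    product of cosh (a z_i), and the sum of the z_i^2 is 1. *)
Lemma mgf_uniform_direction (n : 'rV[R]_d) :
  E (fun z => expR (dotp z n)) <= expR (2 * (l2norm n ^+ 2 / d%:R)).
Proof.
pose a : R := l2norm n / Num.sqrt d%:R.
have a2 : a ^+ 2 = l2norm n ^+ 2 / d%:R.
  by rewrite /a expr_div_n (@sqr_sqrtr _ d%:R) ?ler0n.
have a0 : 0 <= a by rewrite divr_ge0 ?l2norm_ge0 ?sqrtr_ge0.
pose w : 'rV[R]_d := const_mx a.
have nw : l2norm n = l2norm w.
  apply/eqP; rewrite -(@eqrXn2 _ 2) ?l2norm_ge0 //; apply/eqP.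
  rewrite [RHS]l2norm_sqr /dotp (eq_bigr (fun=> a ^+ 2)); last first.
    by move=> i _; rewrite mxE expr2.
  rewrite sumr_const card_ord a2 -(mulr_natr (_ / _) d) divfK //; exact: lt0r_neq0.
rewrite (mean_dotp_norm nw); last by apply: bm_expR; exact: bm_dotp.
have be (e : {ffun 'I_d -> bool}) : bounded_measurable S
    (fun z => expR (\sum_i a * ((-1) ^+ e i * z ord0 i))).
  have := bm_mul_orthogonal (sign_matrix_orthogonal e)
    (bm_expR (bm_dotp w)).
  by under eq_fun do rewrite dotp_sign_matrix.
have h (e : {ffun 'I_d -> bool}) : E (fun z => expR (dotp z w)) =
    E (fun z => expR (\sum_i a * ((-1) ^+ e i * z ord0 i))).
  rewrite -(mean_mul_orthogonal usigma (sign_matrix_orthogonal e)).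
    by apply: eq_mean => z _; rewrite dotp_sign_matrix.
  by apply: bm_expR; exact: bm_dotp.
have p2 : 0 < (2 ^+ d : R) by rewrite exprn_gt0.
rewrite -(ler_pM2l p2).
have -> : 2 ^+ d * E (fun z => expR (dotp z w)) =
    E (fun z => \sum_(e : {ffun 'I_d -> bool})
                  expR (\sum_i a * ((-1) ^+ e i * z ord0 i))).
  rewrite mean_sum // (eq_bigr (fun=> E (fun z => expR (dotp z w)))).
    by rewrite sumr_const card_ffun card_bool card_ord -(mulr_natl _ (2 ^ d)) natrX.
  by move=> e _; rewrite -h.
rewrite -(mean_cst mS S1 (2 ^+ d * _)).
apply: le_mean => //; [exact: bm_sum|exact: bm_cst|].
move=> z Sz.
have -> : \sum_(e : {ffun 'I_d -> bool}) expR (\sum_i a * ((-1) ^+ e i * z ord0 i))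
    = \prod_i (2 * coshR (a * z ord0 i)).
  transitivity (\prod_i \sum_(b : bool) expR (a * ((-1) ^+ b * z ord0 i))).
    rewrite bigA_distr_bigA; apply: eq_bigr => e _.
    by rewrite expR_sum.
  apply: eq_bigr => i _; rewrite -coshRE big_bool /= expr0 expr1 addrC.
  by congr (expR _ + expR _); ring.
rewrite big_split /= prodr_const card_ord ler_pM2l //.
apply: (@le_trans _ _ (\prod_i expR (2 * (a * z ord0 i) ^+ 2))).
  by apply: ler_prod => i _; rewrite (ltW (coshR_gt0 _)) coshR_le.
rewrite -expR_sum ler_expR -mulr_sumr ler_pM2l //.
under eq_bigr do rewrite exprMn.
rewrite -mulr_sumr a2 -[leRHS]mulr1 ler_wpM2l //.
  by rewrite divr_ge0 ?sqr_ge0 // ltW.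
rewrite -(sphere_dotp Sz) /dotp; apply: ler_sum => i _; by rewrite expr2.
Qed.

Lemma cosh_uniform_direction (n : 'rV[R]_d) :
  E (fun z => coshR (dotp z n)) <= expR (2 * (l2norm n ^+ 2 / d%:R)).
Proof.
have b u : bounded_measurable S (fun z => expR (dotp z u)).
  by apply: bm_expR; exact: bm_dotp.
have -> : E (fun z => coshR (dotp z n)) =
    2^-1 * (E (fun z => expR (dotp z n)) + E (fun z => expR (dotp z (- n)))).
  rewrite -meanD // -meanZ //; last exact: bmD.
  by apply: eq_mean => z _; rewrite /coshR dotpNr mulrC.
rewrite mulrC ler_pdivrMr // mulr_natr mulr2n; apply: lerD.
  exact: mgf_uniform_direction.
by rewrite -(l2normN n); exact: mgf_uniform_direction.
Qed.

(** All coordinates have the same second moment, and their squares add up to 1. *)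
Lemma mean_dotp_sqr (u : 'rV[R]_d) : l2norm u = 1 ->
  E (fun z => dotp z u ^+ 2) = d%:R^-1.
Proof.
move=> u1.
have bu v : bounded_measurable S (fun z => dotp z v ^+ 2).
  by apply: bmX; exact: bm_dotp.
have dotpe (z : 'rV[R]_d) i : dotp z (delta_mx ord0 i) = z ord0 i.
  rewrite /dotp (bigD1 i) //= big1 ?addr0 => [|j ji].
    by rewrite mxE !eqxx mulr1.
  by rewrite mxE eqxx (negbTE ji) mulr0.
have ei i : l2norm (delta_mx ord0 i : 'rV[R]_d) = l2norm u.
  by rewrite u1 l2normE dotpe mxE !eqxx sqrtr1.
apply: (mulfI (lt0r_neq0 pd)); rewrite mulfV ?lt0r_neq0 //.
transitivity (E (fun z => \sum_i dotp z (delta_mx ord0 i) ^+ 2)).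
  rewrite mean_sum // (eq_bigr (fun=> E (fun z => dotp z u ^+ 2))).
    by rewrite sumr_const card_ord mulr_natl.
  by move=> i _; exact: (mean_dotp_norm (h := fun t => t ^+ 2) (ei i) (bu _)).
rewrite -[RHS](mean_cst mS S1); apply: eq_mean => z Sz.
by rewrite -(sphere_dotp Sz); apply: eq_bigr => i _; rewrite dotpe expr2.
Qed.

Lemma mean_dotp_quartic (u : 'rV[R]_d) : l2norm u = 1 ->
  E (fun z => (Num.sqrt d%:R * dotp z u) ^+ 4) <= (32 * expR 1) ^+ 2.
Proof.
move=> u1; set q := Num.sqrt _.
have q2 : q ^+ 2 = d%:R by rewrite sqr_sqrtr ?ler0n.
have H := cosh_uniform_direction (q *: u).
rewrite l2normZ u1 mulr1 ger0_norm ?sqrtr_ge0 // q2 divff ?lt0r_neq0 // in H.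
have bq : bounded_measurable S (fun z => q * dotp z u).
  by apply: bmZ; exact: bm_dotp.
apply: (@le_trans _ _ (E (fun z => 2 * 4 ^+ 4 * coshR (dotp z (q *: u))))).
  apply: le_mean => //; [exact: bmX | |].
    by apply: bmZ; apply: bm_coshR; exact: bm_dotp.
  by move=> z _; rewrite -dotpZr; exact: quartic_le_coshR.
rewrite meanZ //; last by apply: bm_coshR; exact: bm_dotp.
have -> : (32 * expR 1) ^+ 2 = 32 ^+ 2 * expR (2 * 1) :> R.
  by rewrite exprMn mulrC [in RHS]mulrC expRM_natl.
apply: (@le_trans _ _ (2 * 4 ^+ 4 * expR (2 * 1))).
  by rewrite ler_pM2l // mulr_gt0 // exprn_gt0.
by rewrite ler_pM2r ?expR_gt0 // !exprS expr0; lra.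
Qed.

End direction_moments.

(** * The mean direction of a noiseless comparison *)

Section sign_pm.
Context {R : realType}.
Implicit Types (b : bool) (t : R).

Lemma sign_pmE b t :
  sign_pm b t = if (if b then 0 < t else 0 <= t) then 1 else -1.
Proof.
rewrite /sign_pm; have [t0|t0|_] := ltgtP t 0.
- by rewrite ltr0_sg //; case: b.
- by rewrite gtr0_sg //; case: b.
- by case: b; rewrite ?expr1 ?expr0.
Qed.

Lemma sign_pm_or b t : sign_pm b t = 1 \/ sign_pm b t = -1.
Proof. by rewrite sign_pmE; case: ifP; [left|right]. Qed.

Lemma normr_sign_pm b t : `|sign_pm b t| = 1.
Proof. by case: (sign_pm_or b t) => ->; rewrite ?normrN normr1. Qed.

Lemma sign_pm_gt0 b t : 0 < t -> sign_pm b t = 1.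
Proof. by move=> t0; rewrite sign_pmE t0 ltW //; case: b. Qed.

Lemma sign_pm_lt0 b t : t < 0 -> sign_pm b t = -1.
Proof.
by move=> t0; rewrite sign_pmE leNgt t0 ltNge (ltW t0); case: b.
Qed.

Lemma sign_pm_mul b t : sign_pm b t * t = `|t|.
Proof.
have [t0|t0|->] := ltgtP t 0; last by rewrite mulr0 normr0.
- by rewrite sign_pm_lt0 // mulN1r ltr0_norm.
- by rewrite sign_pm_gt0 // mul1r gtr0_norm.
Qed.

Lemma measurable_sign_pm b : measurable_fun [set: R] (sign_pm b).
Proof.
rewrite (_ : sign_pm b = fun t => if (if b then 0 < t else 0 <= t) then 1 else -1);
  last by apply/funext => t; rewrite sign_pmE.
apply: measurable_fun_ifT => //; case: b.
- exact: measurable_fun_ltr.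
- exact: measurable_fun_ler.
Qed.

End sign_pm.

(** A polynomial lower bound for |t| 1(|t| > 3/4) whose mean is positive when t is
    a normalized coordinate of a random direction: t^2 then has mean 1, 9/16 is
    the square of 3/4, and the quartic term has mean at most 1/4 because t^4 has
    mean at most (32 e)^2. The outer factor keeps the polynomial below t. *)
Definition quartic_minorant {R : realType} (t : R) : R :=
  (t ^+ 2 - 9 / 16 - t ^+ 4 / (64 * expR 1) ^+ 2) / (64 * expR 1).

(** The mean of [quartic_minorant] is at least (1 - 9/16 - 1/4) / (64 e). *)
Definition drift_constant (R : realType) : R := 3 / 16 / (64 * expR 1).

Section quartic_minorant.
Context {R : realType}.
Implicit Type t : R.
Local Notation K := (64 * expR 1 : R).

Let K0 : 0 < K. Proof. by rewrite mulr_gt0 // expR_gt0. Qed.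

Lemma drift_constant_gt0 : 0 < drift_constant R.
Proof. by rewrite !divr_gt0. Qed.

Lemma quartic_minorantN t : quartic_minorant (- t) = quartic_minorant t.
Proof.
rewrite /quartic_minorant sqrrN.
by rewrite (_ : (- t) ^+ 4 = t ^+ 4) //; ring.
Qed.

Lemma quartic_minorant_le0 t : 0 <= t -> t <= 3 / 4 -> quartic_minorant t <= 0.
Proof.
move=> t0 t1; rewrite pmulr_lle0 ?invr_gt0 //.
have : 0 <= t ^+ 4 / K ^+ 2.
  by rewrite divr_ge0 ?exprn_ge0 // ltW.
have : t ^+ 2 <= (3 / 4) ^+ 2 by rewrite lerXn2r ?nnegrE //; lra.
rewrite !expr2; lra.
Qed.

Lemma quartic_minorant_le t : 0 <= t -> quartic_minorant t <= t.
Proof.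
move=> t0; rewrite ler_pdivrMr //.
have [tK|/ltW Kt] := leP t K.
  have : 0 <= t ^+ 4 / K ^+ 2 by rewrite divr_ge0 ?exprn_ge0 // ltW.
  have : t ^+ 2 <= t * K by rewrite expr2 ler_wpM2l.
  lra.
have : t ^+ 2 <= t ^+ 4 / K ^+ 2.
  rewrite ler_pdivlMr ?exprn_gt0 // (_ : 4 = 2 + 2)%N // exprD.
  by rewrite ler_wpM2l ?exprn_ge0 // lerXn2r // nnegrE // ltW.
have : 0 <= t * K by rewrite mulr_ge0 // ltW.
lra.
Qed.

End quartic_minorant.

Section drift.
Context {R : realType} {d : nat}.
Variables (sigma : probability (borel_rV R d) R) (f : 'rV[R]_d -> R).
Variables (b : bool) (x : 'rV[R]_d) (L r : R).
Hypothesis usigma : uniform_on_sphere sigma.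
Hypothesis d0 : (0 < d)%N.
Hypothesis df : forall y, differentiable f y.
Hypotheses (L0 : 0 <= L) (r0 : 0 < r).
Hypothesis Lf :
  forall y z, l2norm (gradient f y - gradient f z) <= L * l2norm (y - z).
Hypothesis cf : convex_function [set: 'rV[R]_d] f.
Let g := gradient f x.
Hypothesis g0 : 0 < l2norm g.
Hypothesis Lr : L * r * Num.sqrt d%:R <= l2norm g.

Notation S := (@sphere R d).
Notation E := (mean sigma S).
Notation bm := (bounded_measurable S).

Let S1 : sigma S = 1%E. Proof. by case: usigma. Qed.
Let mS : measurable S := measurable_sphere.
Let pd : 0 < (d%:R : R). Proof. by rewrite ltr0n. Qed.
Let q : R := Num.sqrt d%:R.
Let q0 : 0 < q. Proof. by rewrite sqrtr_gt0. Qed.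
Let q2 : q ^+ 2 = d%:R. Proof. by rewrite sqr_sqrtr // ltW. Qed.

Definition increment (v : 'rV[R]_d) : R := f (x + r *: v) - f x.

Definition comparison (v : 'rV[R]_d) : R := sign_pm b (increment v).

Let gb : 'rV[R]_d := (l2norm g)^-1 *: g.

Let gb1 : l2norm gb = 1.
Proof.
by rewrite l2normZ ger0_norm ?invr_ge0 ?l2norm_ge0 // mulVf ?lt0r_neq0.
Qed.

Let dotpg v : dotp g v = l2norm g * dotp v gb.
Proof. by rewrite dotpZr mulrA mulfV ?lt0r_neq0 // mul1r dotpC. Qed.

Lemma measurable_increment : measurable_fun [set: borel_rV R d] increment.
Proof.
apply: measurable_funB; last exact: measurable_cst.
have mf : measurable_fun [set: borel_rV R d] f.
  apply: continuous_measurable_borel => y.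
  exact: differentiable_continuous.
exact: (measurableT_comp mf (measurable_ray x r)).
Qed.

Lemma bm_comparison : bm comparison.
Proof.
split.
  exact: (measurableT_comp (measurable_sign_pm b) measurable_increment).
by exists 1 => v _; rewrite normr_sign_pm.
Qed.

Lemma bm_increment : bm increment.
Proof.
split; first exact: measurable_increment.
exists (l2norm g * r + L * r * r) => v Sv.
have nrv : l2norm (r *: (v : 'rV[R]_d)) = r.
  by rewrite l2normZ (Sv : l2norm _ = 1) mulr1 gtr0_norm.
have h0 : l2norm (0 : 'rV[R]_d) <= r by rewrite l2norm0 ltW.
have h1 : l2norm (r *: (v : 'rV[R]_d)) <= r by rewrite nrv.
have := lipschitz_gradient_remainder x df L0 Lf h0 h1.
rewrite addr0 subr0 nrv -/(increment v) => A.
have := ler_norm_dotp g (r *: v); rewrite nrv => B.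
rewrite -[increment v](subrK (dotp g (r *: v))) addrC.
by apply: (le_trans (ler_normD _ _)); apply: lerD.
Qed.

(** The mean of |increment (z O)| is the same for all orthogonal O. As it
    dominates comparison z * increment (z O), with equality when O is the
    identity, no O improves the correlation of the comparison with the increment.
    The increment is linear up to an error controlled by the displacement
    |z O - z|; when O is the reflection that exchanges the gradient direction
    with [u], the linear parts are the correlations with these two directions. *)
Lemma comparison_maximizer (u : 'rV[R]_d) : l2norm u = 1 ->
  E (fun z => comparison z * dotp z u)
    <= E (fun z => comparison z * dotp z gb) + 2 / d%:R.
Proof.
move=> u1; have [->|n0] := eqVneq u gb.
  by rewrite lerDl divr_ge0 // ltW.
pose n := gb - u.
have nn : l2norm n != 0.
  by apply: contra_neq n0 => /l2norm_eq0/subr0_eq.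
have pn : 0 < l2norm n by rewrite lt_neqAle eq_sym nn l2norm_ge0.
pose nh := (l2norm n)^-1 *: n.
have nh1 : l2norm nh = 1.
  by rewrite l2normZ ger0_norm ?invr_ge0 ?l2norm_ge0 // mulVf.
pose O := reflection n.
have oO : O *m O^T = 1%:M := reflection_orthogonal n.
have dO z : dotp (z *m O) gb = dotp z u.
  by apply: dotp_reflection_swap; rewrite gb1.
have displacement (z : 'rV[R]_d) : l2norm (z *m O - z) = 2 * `|dotp z nh|.
  have -> : z *m O - z = - ((2 * dotp z nh) *: nh).
    rewrite mul_reflection addrAC subrr add0r scalerA dotpZr -l2norm_sqr.
    by congr (- (_ *: _)); field.
  by rewrite l2normN l2normZ nh1 mulr1 normrM ger0_norm.
pose w z := comparison z * (dotp z u - dotp z gb).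
have bw : bm w by apply: bmM bm_comparison _; apply: bmB; exact: bm_dotp.
have pointwise z : S z ->
    r * l2norm g * w z
      <= `|increment (z *m O)| - `|increment z|
         + L * r ^+ 2 * (q * dotp z nh ^+ 2 + q^-1).
  move=> Sz.
  have nz y : S y -> l2norm (r *: (y : 'rV[R]_d)) <= r.
    by move=> Sy; rewrite l2normZ (Sy : l2norm _ = 1) mulr1 gtr0_norm.
  have SzO : S (z *m O) by rewrite sphere_mul_orthogonal.
  have := lipschitz_gradient_remainder x df L0 Lf (nz _ Sz) (nz _ SzO).
  rewrite -scalerBr l2normZ (gtr0_norm r0) displacement -/g dotpZr dotpBr !dotpg dO.
  have -> : f (x + r *: (z *m O)) - f (x + r *: z) = increment (z *m O) - increment z.
    by rewrite /increment opprB addrA subrK.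
  set a := increment _; set c := increment z => H.
  have H1 : comparison z * a <= `|a|.
    by apply: (le_trans (ler_norm _)); rewrite normrM normr_sign_pm mul1r.
  have H2 : comparison z * c = `|c| by exact: sign_pm_mul.
  have H3 : - comparison z * (a - c - r * (l2norm g * dotp z u - l2norm g * dotp z gb))
      <= L * r * (r * (2 * `|dotp z nh|)).
    apply: (le_trans (ler_norm _)).
    by rewrite normrM normrN normr_sign_pm mul1r.
  (* Through AM-GM the mean of |z.nh| only involves the second moment. *)
  have H4 : 2 * `|dotp z nh| <= q * dotp z nh ^+ 2 + q^-1.
    rewrite -(ler_pM2l q0) mulrDr mulfV ?lt0r_neq0 // -real_normK ?num_real //.
    by have := sqr_ge0 (q * `|dotp z nh| - 1); rewrite sqrrB1 exprMn !expr2; lra.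
  have H5 : L * r * (r * (2 * `|dotp z nh|)) <= L * r ^+ 2 * (q * dotp z nh ^+ 2 + q^-1).
    rewrite (_ : L * r * _ = L * r ^+ 2 * (2 * `|dotp z nh|)); last by ring.
    by rewrite ler_wpM2l // mulr_ge0 // sqr_ge0.
  rewrite /w; lra.
have bi := bm_increment.
have bn : bm (fun z => dotp z nh ^+ 2) by apply: bmX; exact: bm_dotp.
have b1 : bm (fun z => `|increment (z *m O)| - `|increment z|).
  exact: bmB (bm_mul_orthogonal oO (bm_norm bi)) (bm_norm bi).
have b2 : bm (fun z => q * dotp z nh ^+ 2 + q^-1).
  by apply: bmD; [exact: bmZ|exact: bm_cst].
have := le_mean sigma mS _ _ pointwise.
move=> /(_ (bmZ _ bw) (bmD b1 (bmZ _ b2))).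
rewrite meanZ // meanD //; last exact: bmZ.
rewrite (meanB sigma mS (bm_mul_orthogonal oO (bm_norm bi)) (bm_norm bi)).
rewrite (mean_mul_orthogonal usigma oO (bm_norm bi)) subrr add0r.
rewrite meanZ // meanD //; [|exact: bmZ|exact: bm_cst].
rewrite meanZ // (mean_cst mS S1) (mean_dotp_sqr usigma d0 nh1).
have -> : E w = E (fun z => comparison z * dotp z u)
                - E (fun z => comparison z * dotp z gb).
  rewrite -meanB //; try by apply: bmM bm_comparison _; exact: bm_dotp.
  by apply: eq_mean => z _; rewrite /w mulrBr.
rewrite -lerBlDl => H.
have P : 0 < r * l2norm g by rewrite mulr_gt0.
rewrite -(ler_pM2l P); apply: (le_trans H).
rewrite -q2 (_ : q * (q ^+ 2)^-1 = q^-1); last by field; exact: lt0r_neq0.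
have -> : L * r ^+ 2 * (q^-1 + q^-1) = r * (L * r * q) * (2 / q ^+ 2).
  by field; exact: lt0r_neq0.
rewrite ler_wpM2r ?divr_ge0 ?sqr_ge0 // ler_wpM2l //; exact: ltW.
Qed.

(** In units where the linear part of the increment is t = sqrt d * (z.gb),
    convexity puts the increment above t and smoothness below t + 3/4. So the
    comparison is 1 for t > 0 and -1 for t < -3/4. When 0 < |t| <= 3/4, it has the
    sign of t at one of z and -z, which makes up for the other; so the mean of
    comparison * t over such a pair is at least |t| 1(|t| > 3/4). *)
Lemma comparison_drift :
  drift_constant R / Num.sqrt d%:R <= E (fun z => comparison z * dotp z gb).
Proof.
have oN : (-1)%:M *m ((-1)%:M : 'M[R]_d)^T = 1%:M.
  by rewrite tr_scalar_mx -scalar_mxM mulrNN mulr1.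
have bd := @bm_dotp R d gb.
have bc := bm_comparison.
have bN : bm (fun z => comparison (z *m (-1)%:M)).
  exact: (bm_mul_orthogonal oN bc).
have NE (z : 'rV[R]_d) : z *m (-1)%:M = - z.
  by rewrite mul_mx_scalar scaleN1r.
pose t z := q * dotp z gb.
have bt : bm t by exact: bmZ.
have inc (z : 'rV[R]_d) : S z ->
    r * l2norm g / q * t z <= increment z /\
    increment z <= r * l2norm g / q * (t z + 3 / 4).
  move=> Sz.
  have nz : l2norm (r *: z) <= r.
    by rewrite l2normZ (Sz : l2norm _ = 1) mulr1 gtr0_norm.
  have lo := convex_gradient_lower x (r *: z) df L0 Lf cf.
  have up := lipschitz_gradient_upper x df L0 Lf nz.
  have e : dotp g (r *: z) = r * l2norm g / q * t z.
    by rewrite dotpZr dotpg /t; field; exact: lt0r_neq0.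
  rewrite -/g e in lo up; split => //; apply: (le_trans up).
  rewrite mulrDr lerD2l (_ : _ * L * r ^+ 2 = r * (L * r * q) / q * (3 / 4)).
    rewrite ler_pM2r // ler_pM2r ?invr_gt0 // ler_pM2l //.
  by field; exact: lt0r_neq0.
have k0 : 0 < r * l2norm g / q by rewrite divr_gt0 // mulr_gt0.
have comp_pos (z : 'rV[R]_d) : S z -> 0 < t z -> comparison z = 1.
  move=> Sz tz; apply: sign_pm_gt0; have [lo _] := inc z Sz.
  by apply: lt_le_trans lo; rewrite mulr_gt0.
have comp_neg (z : 'rV[R]_d) : S z -> t z < - (3 / 4) -> comparison z = -1.
  move=> Sz tz; apply: sign_pm_lt0; have [_ up] := inc z Sz.
  by apply: (le_lt_trans up); rewrite pmulr_rlt0 //; lra.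
have tN (z : 'rV[R]_d) : t (- z) = - t z by rewrite /t dotpNl mulrN.
have half (z : 'rV[R]_d) : S z -> S (- z) -> 0 <= t z ->
    2 * quartic_minorant (t z) <= (comparison z - comparison (- z)) * t z.
  move=> Sz SNz tz.
  have [tz34|tz34] := leP (t z) (3 / 4).
    have h := quartic_minorant_le0 tz tz34.
    suff : 0 <= (comparison z - comparison (- z)) * t z by lra.
    move: tz; rewrite le_eqVlt => /predU1P[<-|tz]; first by rewrite mulr0.
    rewrite mulr_ge0 ?(ltW tz) // comp_pos //.
    by rewrite /comparison; case: (sign_pm_or b (increment (- z))) => ->; lra.
  have h := quartic_minorant_le tz.
  by rewrite comp_pos ?(comp_neg (- z)) ?tN //; lra.
have pointwise z : S z -> 2 * quartic_minorant (t z)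
    <= (comparison z - comparison (z *m (-1)%:M)) * t z.
  move=> Sz; have SN : S (- z) by rewrite -NE sphere_mul_orthogonal.
  rewrite NE; have [tz|/ltW tz] := leP 0 (t z); first exact: half.
  have := half _ SN; rewrite opprK tN quartic_minorantN => /(_ Sz).
  rewrite oppr_ge0 => /(_ tz); lra.
have bq : bm (fun z => quartic_minorant (t z)).
  apply: bmM; last exact: bm_cst.
  apply: bmB; last by apply: bmM; [exact: bmX | exact: bm_cst].
  by apply: bmB; [exact: bmX | exact: bm_cst].
have bcN : bm (fun z => (comparison z - comparison (z *m (-1)%:M)) * t z).
  by apply: bmM => //; exact: bmB.
have Emin : drift_constant R <= E (fun z => quartic_minorant (t z)).
  have b2 : bm (fun z => t z ^+ 2) by exact: bmX.
  have b4 : bm (fun z => t z ^+ 4) by exact: bmX.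
  pose K : R := 64 * expR 1.
  have K0 : 0 < K by rewrite mulr_gt0 // expR_gt0.
  have -> : E (fun z => quartic_minorant (t z)) =
      K^-1 * (E (fun z => t z ^+ 2) - 9 / 16 - (K ^+ 2)^-1 * E (fun z => t z ^+ 4)).
    rewrite -meanZ // -[9 / 16](mean_cst mS S1) -meanB //; last exact: bm_cst.
    rewrite -meanB //; [|by apply: bmB => //; exact: bm_cst|exact: bmZ].
    rewrite -meanZ //; last first.
      by apply: bmB; [apply: bmB => //; exact: bm_cst|exact: bmZ].
    by apply: eq_mean => z _; rewrite /quartic_minorant -/K mulrC [_ * t z ^+ 4]mulrC.
  have -> : E (fun z => t z ^+ 2) = 1.
    rewrite (_ : E _ = E (fun z => d%:R * dotp z gb ^+ 2)).
      rewrite meanZ //; last exact: bmX.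
      by rewrite (mean_dotp_sqr usigma d0 gb1) mulfV // lt0r_neq0.
    by apply: eq_mean => z _; rewrite /t exprMn q2.
  have h4 := mean_dotp_quartic usigma d0 gb1; rewrite -/q -/t in h4.
  have h5 : (K ^+ 2)^-1 * E (fun z => t z ^+ 4) <= 4^-1.
    rewrite mulrC ler_pdivrMr ?exprn_gt0 //; apply: (le_trans h4).
    by rewrite le_eqVlt; apply/orP; left; apply/eqP; rewrite /K; field.
  rewrite /drift_constant -/K mulrC ler_pM2l ?invr_gt0 //; lra.
have H := le_mean sigma mS (bmZ 2 bq) bcN pointwise.
rewrite meanZ // in H.
have e : E (fun z => (comparison z - comparison (z *m (-1)%:M)) * t z) =
    2 * (q * E (fun z => comparison z * dotp z gb)).
  have bct : bm (fun z => comparison z * t z) by exact: bmM.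
  have <- : E (fun z => comparison z * t z) = q * E (fun z => comparison z * dotp z gb).
    rewrite -meanZ //; last exact: bmM.
    by apply: eq_mean => z _; rewrite /t mulrCA.
  rewrite mulr_natl mulr2n -{2}(mean_mul_orthogonal usigma oN bct) -meanD //.
    apply: eq_mean => z _; rewrite NE tN; ring.
  exact: (bm_mul_orthogonal oN bct).
rewrite e ler_pM2l // in H.
rewrite ler_pdivrMr // mulrC; exact: le_trans H.
Qed.

End drift.

(** * Products of independent variables *)

Section weighted_integral.
Context {R : realType} {dT dU : measure_display}.
Context {T : measurableType dT} {U : measurableType dU}.
Variables (P : probability T R) (xi : T -> U) (H : T -> R).
Hypotheses (mxi : measurable_fun [set: T] xi).
Hypotheses (mH : measurable_fun [set: T] H) (H0 : forall t, 0 <= H t).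

Import HBNNSimple.

Lemma nnsfun_weighted_integral (g : {nnsfun U >-> R}) :
  (\int[P]_t (g (xi t) * H t)%:E =
   \sum_(i < #|` fset_set (range g)|)
     ((fset_set (range g))`_i)%:E *
     \int[P]_(t in xi @^-1` (g @^-1` [set (fset_set (range g))`_i])) (H t)%:E)%E.
Proof.
pose s := fset_set (range g).
pose F i t := (s`_i * \1_(g @^-1` [set s`_i]) (xi t) * H t).
have mA (y : R) : measurable (xi @^-1` (g @^-1` [set y])).
  by rewrite -[X in measurable X]setTI; apply: mxi => //; exact: measurable_funPTI.
have mind i : measurable_fun setT (fun t => \1_(g @^-1` [set s`_i]) (xi t) : R).
  have m1 : measurable_fun setT (\1_(g @^-1` [set s`_i]) : U -> R).
    by apply: measurable_indic; exact: measurable_funPTI.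
  exact: (measurableT_comp m1 mxi).
have F0 i t : 0 <= F i t.
  by rewrite mulr_ge0 // -lee_fin EFinM; exact: nnfun_muleindic_ge0.
under eq_integral => t _ do rewrite fimfunEord mulr_suml -sumEFin.
rewrite ge0_integral_sum //; last 2 first.
- move=> i; apply/measurable_EFinP; apply: measurable_funM => //.
  exact: measurable_funM.
- by move=> i t _; rewrite lee_fin F0.
apply: eq_bigr => i _.
have si : 0 <= s`_i.
  have : s`_i \in s by apply: mem_nth.
  by rewrite in_fset_set // => /set_mem[u _ <-]; exact: fun_ge0.
under eq_integral => t _ do rewrite -mulrA EFinM.
rewrite ge0_integralZl //; last 2 first.
- apply/measurable_EFinP; exact: measurable_funM.
- by move=> t _; rewrite lee_fin mulr_ge0.
congr (_ * _)%E; rewrite [RHS]integral_mkcond; apply: eq_integral => t _.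
rewrite patchE indicE; case: ifPn => [/set_mem tA|tA].
  by rewrite mem_set // mul1r.
by rewrite memNset ?mul0r // => h; move/negP: tA; apply; exact: mem_set.
Qed.

Lemma cvg_weighted_integral (G : U -> R) (mG : measurable_fun [set: U] (EFin \o G)) :
    (forall u, 0 <= G u) ->
  (\int[P]_t (nnsfun_approx measurableT mG n (xi t) * H t)%:E @[n --> \oo]
     --> \int[P]_t (G (xi t) * H t)%:E)%E.
Proof.
move=> G0; pose g := nnsfun_approx measurableT mG.
have lim_g t : (limn (fun n => (g n (xi t) * H t)%:E) = (G (xi t) * H t)%:E)%E.
  apply/cvg_lim => //; under eq_fun do rewrite EFinM.
  rewrite EFinM; apply: cvgeZr => //.
  by apply: cvg_nnsfun_approx => // u _; rewrite lee_fin.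
rewrite (eq_integral (fun t => limn (fun n => (g n (xi t) * H t)%:E)));
  last by move=> t _; rewrite lim_g.
apply: (@cvg_monotone_convergence _ _ _ P _ measurableT
  (fun n t => (g n (xi t) * H t)%:E)).
- move=> n; apply/measurable_EFinP; apply: measurable_funM => //.
  exact: measurableT_comp.
- by move=> n t _; rewrite lee_fin mulr_ge0 //; exact: fun_ge0.
- move=> t _ m n mn; rewrite lee_fin ler_wpM2r //.
  exact/lefP/nd_nnsfun_approx.
Qed.

End weighted_integral.

Section eq_weighted_integral.
Import HBNNSimple.

(** Both sides agree for simple functions of [xi], hence for their monotone
    limits. *)
Lemma eq_weighted_integral (R : realType) (dT dU : measure_display)
    (T : measurableType dT) (U : measurableType dU) (P : probability T R)
    (xi : T -> U) (H1 H2 : T -> R) (G : U -> R) :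
    measurable_fun [set: T] xi ->
    measurable_fun [set: T] H1 -> (forall t, 0 <= H1 t) ->
    measurable_fun [set: T] H2 -> (forall t, 0 <= H2 t) ->
    measurable_fun [set: U] G -> (forall u, 0 <= G u) ->
    (forall A, measurable A -> (\int[P]_(t in xi @^-1` A) (H1 t)%:E =
                               \int[P]_(t in xi @^-1` A) (H2 t)%:E)%E) ->
  (\int[P]_t (G (xi t) * H1 t)%:E = \int[P]_t (G (xi t) * H2 t)%:E)%E.
Proof.
move=> mxi mH1 H10 mH2 H20 mG G0 HA.
have mGE : measurable_fun setT (EFin \o G) by exact/measurable_EFinP.
have c1 := cvg_weighted_integral (P := P) mxi mH1 H10 mGE G0.
have c2 := cvg_weighted_integral (P := P) mxi mH2 H20 mGE G0.
have e : (fun n => \int[P]_t (nnsfun_approx measurableT mGE n (xi t) * H1 t)%:E)%E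
       = (fun n => \int[P]_t (nnsfun_approx measurableT mGE n (xi t) * H2 t)%:E)%E.
  apply/funext => n; rewrite !nnsfun_weighted_integral //.
  by apply: eq_bigr => i _; rewrite HA //; exact: measurable_funPTI.
rewrite -(cvg_lim (@ereal_hausdorff R) c1) -(cvg_lim (@ereal_hausdorff R) c2).
exact: (congr1 (fun h => limn h) e).
Qed.

End eq_weighted_integral.

(** Both sides are finite measures in [A], so a generating pi-system determines
    them. *)
Lemma weighted_measure_unique (R : realType) (dT dU : measure_display)
    (T : measurableType dT) (U : measurableType dU) (P : probability T R)
    (xi : T -> U) (H : T -> R) (c : R) (K : set (set U)) :
    measurable_fun [set: T] xi ->
    measurable_fun [set: T] H -> (forall t, 0 <= H t) -> 0 <= c ->
    @measurable _ U = <<s K >> -> setI_closed K -> K setT ->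
    (forall A, K A -> (\int[P]_(t in xi @^-1` A) (H t)%:E = c%:E * P (xi @^-1` A))%E) ->
  forall A, measurable A ->
    (\int[P]_(t in xi @^-1` A) (H t)%:E = c%:E * P (xi @^-1` A))%E.
Proof.
move=> mxi mH H0 c0 mK IK KT HK.
pose nu (B : set T) := (\int[P]_(t in B) (H t)%:E)%E.
have nu0 : nu set0 = 0%E by rewrite /nu integral_set0.
have nu_ge0 B : (0 <= nu B)%E.
  by apply: integral_ge0 => t _; rewrite lee_fin.
have nu_add : semi_sigma_additive nu.
  by apply: semi_sigma_additive_nng_induced => //; exact/measurable_EFinP.
pose nuM : {measure set T -> \bar R} :=
  HB.pack nu (isMeasure.Build _ _ _ nu nu0 nu_ge0 nu_add).
pose cn : {nonneg R} := NngNum c0.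
have E1 A : K A -> pushforward nuM xi A = mscale cn (pushforward P xi) A.
  by move=> KA; rewrite /mscale /=; exact: HK.
move=> A mA.
have := @measure_unique _ R U K (fun=> setT) mK IK (fun=> KT) _
  (pushforward nuM xi) (mscale cn (pushforward P xi)) (E1 mxi) _ A mA.
apply; first by rewrite bigcup_const.
move=> _; apply: (eq_ind_r (fun z => (z < +oo)%E) _ (E1 mxi _ KT)).
by rewrite /mscale /= /pushforward preimage_setT probability_setT mule1 ltry.
Qed.

(** The factorization is extended from events to functions one index at a time:
    the product of all other factors is a weight, and the hypothesis for the
    remaining index says that this weight is uncorrelated with the events of
    that variable. *)
Lemma independent_integral_prod (R : realType) (dT dU : measure_display)
    (T : measurableType dT) (U : measurableType dU) (P : probability T R)
    (m : nat) (xi : 'I_m -> T -> U) (K : set (set U)) :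
    (forall i, measurable_fun [set: T] (xi i)) ->
    @measurable _ U = <<s K >> -> setI_closed K -> K setT ->
    (forall A : 'I_m -> set U, (forall i, K (A i)) ->
      P (\bigcap_(i in [set: 'I_m]) (xi i @^-1` A i))
        = (\prod_i P (xi i @^-1` A i))%E) ->
  forall (F : 'I_m -> U -> R) (e : 'I_m -> R),
    (forall i, measurable_fun [set: U] (F i)) -> (forall i u, 0 <= F i u) ->
    (forall i, \int[P]_t (F i (xi i t))%:E = (e i)%:E)%E ->
  (\int[P]_t (\prod_i F i (xi i t))%:E = (\prod_i e i)%:E)%E.
Proof.
move=> mxi mK IK KT indep.
have KM A : K A -> measurable A.
  by move=> KA; rewrite mK; exact: sub_sigma_algebra.
have mpre i A : measurable A -> measurable (xi i @^-1` A).
  by move=> mA; rewrite -[X in measurable X]setTI; apply: mxi.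
have fineP B : measurable B -> (fine (P B))%:E = P B.
  by move=> mB; rewrite fineK // fin_num_measure.
suff H (k : nat) (F : 'I_m -> U -> R) (e : 'I_m -> R) :
    (forall i, measurable_fun [set: U] (F i)) -> (forall i u, 0 <= F i u) ->
    (forall i, \int[P]_t (F i (xi i t))%:E = (e i)%:E)%E ->
    (forall i : 'I_m, (k <= i)%N -> exists2 A, K A & F i = \1_A) ->
    (\int[P]_t (\prod_i F i (xi i t))%:E = (\prod_i e i)%:E)%E.
  move=> F e mF F0 eF; apply: (H m) => // i.
  by rewrite leqNgt ltn_ord.
elim: k F e => [|k IH] F e mF F0 eF FA.
  have {}FA i : exists A, K A /\ F i = \1_A by have [A] := FA i isT; exists A.
  have [A KA] := choice FA.
  have eA i : e i = fine (P (xi i @^-1` A i)).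
    apply/EFin_inj; rewrite -eF fineP; last by apply: mpre; apply: KM; have [] := KA i.
    rewrite -[X in P X]setIT -integral_indic //.
      by apply: eq_integral => t _; rewrite (KA i).2.
    by apply: mpre; apply: KM; have [] := KA i.
  rewrite (eq_integral (fun t => (\1_(\bigcap_(i in [set: 'I_m]) (xi i @^-1` A i)) t)%:E)).
    rewrite integral_indic //; last first.
      apply: fin_bigcap_measurable => // i _.
      by apply: mpre; apply: KM; have [] := KA i.
    rewrite setIT; apply: (etrans (indep A (fun i => (KA i).1))).
    rewrite -prodEFin; apply: eq_bigr => i _; rewrite eA fineP //.
    by apply: mpre; apply: KM; have [] := KA i.
  move=> t _; congr EFin; under eq_bigr do rewrite (KA _).2.
  rewrite indicE; have [tA|tA] := boolP (t \in _).
    rewrite big1 // => i _; rewrite indicE mem_set //.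
    by move/set_mem: tA; exact.
  have /existsNP[i /not_implyP[_ ti]] : ~ (\bigcap_(i in [set: 'I_m]) (xi i @^-1` A i)) t.
    by move=> h; move/negP: tA; apply; exact: mem_set.
  by rewrite (bigD1 i) //= indicE memNset // mul0r.
have [km|mk] := ltnP k m; last first.
  by apply: IH => // i ki; have := ltn_ord i; rewrite ltnNge (leq_trans mk ki).
pose j := Ordinal km.
pose H t := \prod_(i | i != j) F i (xi i t).
pose c := \prod_(i | i != j) e i.
have e0 i : 0 <= e i.
  by rewrite -lee_fin -eF; apply: integral_ge0 => t _; rewrite lee_fin.
have c0 : 0 <= c by apply: prodr_ge0 => i _.
have mH : measurable_fun setT H.
  rewrite (_ : H = fun t => \prod_i (if i != j then F i (xi i t) else 1));
    last by apply/funext => t; rewrite /H big_mkcond.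
  apply: measurable_prod => i _; case: (i != j); last exact: measurable_cst.
  exact: measurableT_comp.
have H0 t : 0 <= H t by apply: prodr_ge0 => i _.
have HK A : K A -> (\int[P]_(t in xi j @^-1` A) (H t)%:E = c%:E * P (xi j @^-1` A))%E.
  move=> KA; pose F' i := if i == j then \1_A else F i.
  pose e' i := if i == j then fine (P (xi j @^-1` A)) else e i.
  have pe : \prod_i e' i = fine (P (xi j @^-1` A)) * c.
    rewrite (bigD1 j) //= {1}/e' eqxx; congr (_ * _).
    by apply: eq_bigr => i /negbTE ij; rewrite /e' ij.
  have pF t : \prod_i F' i (xi i t) = \1_A (xi j t) * H t.
    rewrite (bigD1 j) //= {1}/F' eqxx; congr (_ * _).
    by apply: eq_bigr => i /negbTE ij; rewrite /F' ij.
  have := IH F' e'.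
  rewrite pe EFinM (fineP _ (mpre _ _ (KM _ KA))) [RHS]muleC => <-.
  - rewrite integral_mkcond; apply: eq_integral => t _.
    rewrite pF indicE patchE; case: ifPn => [/set_mem tA|tA].
      by rewrite mem_set // mul1r.
    by rewrite memNset ?mul0r // => h; move/negP: tA; apply; exact: mem_set.
  - move=> i; rewrite /F'; case: ifP => // _.
    by apply: measurable_indic; exact: KM.
  - by move=> i u; rewrite /F'; case: ifP.
  - move=> i; rewrite /F' /e'; case: eqP => [->|_]; last exact: eF.
    rewrite fineP; last by apply: mpre; exact: KM.
    rewrite -[X in P X]setIT -integral_indic //; exact: mpre (KM _ KA).
  - move=> i ki; rewrite /F'; case: eqP => [_|/eqP ij]; first by exists A.
    apply: FA; rewrite ltn_neqAle ki andbT; apply: contra ij => /eqP kE.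
    by apply/eqP; apply: val_inj.
have Hm := weighted_measure_unique (mxi j) mH H0 c0 mK IK KT HK.
rewrite (eq_integral (fun t => (F j (xi j t) * H t)%:E)); last first.
  by move=> t _; rewrite (bigD1 j).
rewrite (eq_weighted_integral (H2 := fun=> c) (mxi j)) //.
- rewrite (bigD1 j) //= -/c EFinM -eF [RHS]muleC.
  under eq_integral do rewrite mulrC EFinM.
  rewrite ge0_integralZl //.
  + by apply/measurable_EFinP; apply: measurableT_comp.
  + by move=> t _; rewrite lee_fin.
- by move=> A mA; rewrite Hm // integral_cst //; exact: mpre.
Qed.

(** * A uniform deviation bound over the feasible set *)

(** Codes for the integers between -d and d: zero, or a sign and a modulus minus 1.
    Zero has a single code, because a second one would raise the leading term of
    the weight of every coordinate in the union bound below from 1 to 2. *)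
Definition small_int (d : nat) : finType := (unit + bool * 'I_d)%type.

Definition small_int_val {R : realType} {d : nat} (k : small_int d) : R :=
  match k with
  | inl _ => 0
  | inr (b, c) => (-1) ^+ b * c.+1%:R
  end.

Definition grid_point {R : realType} {d : nat} (k : {ffun 'I_d -> small_int d}) :
  'rV[R]_d := \row_i small_int_val (k i).

Section rounding.
Context {R : realType} {d : nat}.

Lemma small_int_round (a : R) : `|a| <= d%:R ->
  exists k : small_int d, let v := small_int_val k : R in
    [/\ `|a - v| <= 1, `|a - v| <= `|a| & v ^+ 2 <= a ^+ 2].
Proof.
move=> ad; have /andP[N1 N2] := truncn_itv (normr_ge0 a).
case N : (Num.truncn `|a|) N1 N2 => [|c] N1 N2.
  by exists (inl tt); rewrite /= subr0 lexx expr0n sqr_ge0 ltW.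
have cd : (c < d)%N by rewrite -(ler_nat R); exact: le_trans ad.
exists (inr (a < 0, Ordinal cd)) => /=.
have ea : a = (-1) ^+ (a < 0)%R * `|a| by rewrite -realEsign // num_real.
have e : `|a - (-1) ^+ (a < 0)%R * c.+1%:R| = `|a| - c.+1%:R.
  by rewrite {1}ea -mulrBr normrM normr_sign mul1r ger0_norm // subr_ge0.
rewrite e; split.
- by move: N2; rewrite -(natr1 c.+1) => /ltW; rewrite lerBlDl.
- by rewrite gerBl.
- by rewrite exprMn sqrr_sign mul1r -[leRHS]real_normK ?num_real // lerXn2r // nnegrE.
Qed.

Lemma small_int_sign (a tau : R) : 0 <= tau -> (0 < d)%N ->
  exists k : small_int d, let v := small_int_val k : R in
    Num.max 0 (`|a| - tau) = a * v - tau * v ^+ 2.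
Proof.
move=> t0 d0; have [h|h] := leP (`|a| - tau) 0.
  by exists (inl tt) => v; rewrite /v /= expr0n !mulr0 subr0.
exists (inr (a < 0, Ordinal d0)) => v; rewrite /v /=.
rewrite mulr1 sqrr_sign mulr1; congr (_ - _).
by rewrite [LHS]normrEsign ?num_real // mulrC.
Qed.

(** Round sqrt s * u towards zero to an integer point: the integer part has
    squared length at most s, and the remainder has coordinates in [-1, 1] and
    l1 norm at most s. The excess of |V i| over tau, summed over i, is the value
    of the hypothesis at a sign vector, so that both parts are controlled. *)
Lemma dotp_feasible_le (V u : 'rV[R]_d) (s tau c : R) :
    0 < s -> s <= d%:R -> 0 <= tau -> 
    (forall k, dotp V (grid_point k) <= tau * l2norm (grid_point k : 'rV[R]_d) ^+ 2 + c) ->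
    one_bit_feasible s u ->
  Num.sqrt s * dotp V u <= 2 * (tau * s + c).
Proof.
move=> s0 sd t0 HV [u1 u2].
have d0 : (0 < d)%N by rewrite -(ltr_nat R); exact: lt_le_trans sd.
set q := Num.sqrt s.
have q2 : q ^+ 2 = s by rewrite sqr_sqrtr // ltW.
have q0 : 0 <= q by exact: sqrtr_ge0.
have dN : 1 <= (d%:R : R) by rewrite ler1n.
have qd : q <= d%:R.
  rewrite -(@ler_pXn2r _ 2) ?nnegrE ?ler0n // q2; apply: (le_trans sd).
  by rewrite expr2 ler_peMl ?ler0n.
pose a i := q * u ord0 i.
have ad i : `|a i| <= d%:R.
  rewrite normrM (ger0_norm q0); apply: le_trans qd.
  by rewrite ler_piMr //; apply: le_trans u2; exact: ler_l2norm_coord.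
have /fin_all_exists[k kP] : forall i, exists k : small_int d,
    let v := small_int_val k : R in
    [/\ `|a i - v| <= 1, `|a i - v| <= `|a i| & v ^+ 2 <= a i ^+ 2].
  by move=> i; exact: small_int_round (ad i).
have /fin_all_exists[l lP] : forall i, exists k : small_int d,
    let v := small_int_val k : R in
    Num.max 0 (`|V ord0 i| - tau) = V ord0 i * v - tau * v ^+ 2.
  by move=> i; exact: small_int_sign.
have gsq (h : 'I_d -> small_int d) :
    l2norm (grid_point (finfun h) : 'rV[R]_d) ^+ 2 = \sum_i small_int_val (h i) ^+ 2.
  rewrite l2norm_sqr; apply: eq_bigr => i _.
  by rewrite !mxE ffunE expr2.
have gdot (h : 'I_d -> small_int d) :
    dotp V (grid_point (finfun h)) = \sum_i V ord0 i * small_int_val (h i).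
  by apply: eq_bigr => i _; rewrite !mxE ffunE.
have A : \sum_i Num.max 0 (`|V ord0 i| - tau) <= c.
  have := HV (finfun l); rewrite gdot gsq mulr_sumr -lerBlDl -sumrB.
  by under eq_bigr do rewrite -lP.
have B : \sum_i V ord0 i * small_int_val (k i) <= tau * s + c.
  rewrite -gdot; apply: (le_trans (HV _)); rewrite lerD2r ler_wpM2l // gsq.
  apply: (@le_trans _ _ (\sum_i a i ^+ 2)).
    by apply: ler_sum => i _; have [] := kP i.
  under eq_bigr do rewrite exprMn.
  rewrite -mulr_sumr q2 ler_piMr ?(ltW s0) //.
  have -> : \sum_i u ord0 i ^+ 2 = l2norm u ^+ 2.
    by rewrite l2norm_sqr; apply: eq_bigr => i _; rewrite expr2.
  by rewrite expr_le1 // l2norm_ge0.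
have C : \sum_i V ord0 i * (a i - small_int_val (k i)) <= tau * s + c.
  apply: (@le_trans _ _ (\sum_i (tau * `|a i| + Num.max 0 (`|V ord0 i| - tau)))).
    apply: ler_sum => i _; have [k1 k2 _] := kP i.
    apply: (le_trans (ler_norm _)); rewrite normrM.
    set e := `|a i - _| in k1 k2 *.
    have e0 : 0 <= e by exact: normr_ge0.
    apply: (@le_trans _ _ ((tau + Num.max 0 (`|V ord0 i| - tau)) * e)).
      rewrite ler_wpM2r // -lerBlDl le_max lexx orbT //.
    rewrite mulrDl lerD // ?ler_wpM2l //.
    by rewrite ler_piMr // le_max lexx.
  rewrite big_split /= -mulr_sumr lerD // ler_wpM2l //.
  under eq_bigr do rewrite normrM (ger0_norm q0).
  by rewrite -mulr_sumr -q2 expr2 ler_wpM2l.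
have -> : q * dotp V u = \sum_i V ord0 i * small_int_val (k i)
                       + \sum_i V ord0 i * (a i - small_int_val (k i)).
  rewrite -big_split mulr_sumr; apply: eq_bigr => i _ /=.
  by rewrite -mulrDr addrC subrK /a mulrCA.
by apply: (le_trans (lerD B C)); lra.
Qed.

(** The partition function of the grid is a product over the coordinates, and
    each factor is a geometric sum around its term 1. *)
Lemma grid_sum_le (q : R) : 0 <= q -> q <= 2^-1 ->
  \sum_(k : {ffun 'I_d -> small_int d})
     \prod_i (if k i is inr (_, c) then q ^+ (c.+1 ^ 2) else 1)
    <= expR (4 * q * d%:R).
Proof.
move=> q0 q1.
pose F (k : small_int d) : R := if k is inr (_, c) then q ^+ (c.+1 ^ 2) else 1.
rewrite -(bigA_distr_bigA (fun _ k => F k)).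
have half n : \sum_(c < n) (2^-1 : R) ^+ c <= 2 - 2 * 2^-1 ^+ n.
  elim: n => [|n IH]; first by rewrite big_ord0 expr0; lra.
  rewrite big_ord_recr /= exprS; apply: (le_trans (lerD IH (lexx _))); lra.
have H : \sum_(k : small_int d) F k <= expR (4 * q).
  rewrite big_sumType /= (big_pred1 tt) /=; last by case.
  rewrite (eq_bigr (fun p : bool * 'I_d => q ^+ (p.2.+1 ^ 2))); last by case.
  rewrite -(pair_bigA _ (fun (b : bool) (c : 'I_d) => q ^+ (c.+1 ^ 2))) /=.
  rewrite big_bool /=.
  have h : \sum_(c < d) q ^+ (c.+1 ^ 2) <= 2 * q.
    apply: (@le_trans _ _ (\sum_(c < d) q * 2^-1 ^+ c)).
      apply: ler_sum => c _.
      apply: (@le_trans _ _ (q ^+ c.+1)).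
        have q1' : q <= 1 by lra.
        by rewrite ler_wiXn2l // -mulnn leq_pmulr.
      by rewrite exprS ler_wpM2l // lerXn2r // nnegrE invr_ge0.
    rewrite -mulr_sumr mulrC ler_wpM2r //; apply: (le_trans (half d)).
    by rewrite gerBl mulr_ge0 // exprn_ge0 // invr_ge0.
  apply: le_trans (expR_ge1Dx _); lra.
apply: (@le_trans _ _ (\prod_(i < d) expR (4 * q))).
  apply: ler_prod => i _; rewrite H andbT; apply: sumr_ge0 => -[//|[b c]] _ /=.
  exact: exprn_ge0.
by rewrite prodr_const card_ord -expRM_natr.
Qed.

End rounding.

Section subgaussian.
Context {R : realType} {dT : measure_display} {T : measurableType dT} {d : nat}.
Variables (P : probability T R).

Lemma markov_expR (Y : T -> R) (th : R) : measurable_fun [set: T] Y ->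
  ((expR th)%:E * P [set t | (th < Y t)%R] <= \int[P]_t (expR (Y t))%:E)%E.
Proof.
move=> mY; set B := [set t | _].
have mB : measurable B.
  rewrite (_ : B = Y @^-1` `]th, +oo[); first by rewrite -[X in measurable X]setTI; apply: mY.
  by apply/seteqP; split => t; rewrite /B /= in_itv /= andbT.
rewrite -integral_cst //.
apply: (@le_trans _ _ (\int[P]_(t in B) (expR (Y t))%:E)%E).
  apply: ge0_le_integral => //.
  - by move=> t _; rewrite lee_fin expR_ge0.
  - by apply/measurable_EFinP; apply: measurable_funTS; exact: measurableT_comp.
  - by move=> t tB; rewrite lee_fin ler_expR ltW.
by apply: ge0_subset_integral => //; apply/measurable_EFinP; exact: measurableT_comp.
Qed.

Lemma measure_bigsetU_le (I : Type) (r : seq I) (B : I -> set T) :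
    (forall i, measurable (B i)) ->
  (P (\big[setU/set0]_(i <- r) B i) <= \sum_(i <- r) P (B i))%E.
Proof.
move=> mB; elim: r => [|i r IH]; first by rewrite !big_nil measure0.
rewrite !big_cons; apply: (le_trans (measureU2 _ _ _)) => //.
  exact: bigsetU_measurable.
exact: leeD2l.
Qed.

(** A union bound over the grid in which the point n is allowed the deviation
    tau |n|^2 + c. The penalty tau is chosen such that n fails with probability
    at most (s / 2d)^(|n|^2) times a common factor; the sum of these weights is
    at most exp(2 s), and c makes the common factor beat it. *)
Lemma subgaussian_feasible_le (V : T -> 'rV[R]_d) (om s : R) :
    0 < om -> 0 < s -> s < d%:R ->
    (forall n, measurable_fun [set: T] (fun t => dotp (V t) n)) ->
    (forall n, \int[P]_t (expR (dotp (V t) n))%:E <= (expR (om * l2norm n ^+ 2))%:E)%E ->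
  let N := s * ln (2 * d%:R / s) in
  exists E : set T, [/\ measurable E, ((1 - expR (- (2 * N)))%:E <= P E)%E &
    forall t, E t -> forall u, one_bit_feasible s u ->
      dotp (V t) u <= 16 * Num.sqrt (om * N)].
Proof.
move=> om0 s0 sd mV mgf; set l := ln _ => N.
have pd : 0 < (d%:R : R) by exact: lt_trans sd.
have x0 : 0 < 2 * d%:R / s by rewrite divr_gt0 // mulr_gt0.
have l2 : 2^-1 <= l.
  rewrite /l -ler_expR lnK ?posrE //.
  apply: (@le_trans _ _ 2); last by rewrite ler_pdivlMr // ler_pM2l // ltW.
  rewrite -[X in expR X]opprK expRN -[leRHS]invrK lef_pV2 ?posrE ?expR_gt0 ?invr_gt0 //.
  by apply: le_trans (expR_ge1Dx _); lra.
have l0 : 0 < l by lra.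
have N0 : 0 < N by rewrite mulr_gt0.
pose q : R := expR (- l).
have qE : q = s / (2 * d%:R) by rewrite /q expRN lnK ?posrE // invf_div.
have q0 : 0 <= q by exact: expR_ge0.
have q1 : q <= 2^-1.
  by rewrite qE ler_pdivrMr ?mulr_gt0 // mulKf ?pnatr_eq0 // ltW.
pose tau := 2 * Num.sqrt (om * l).
have tau2 : tau ^+ 2 = 4 * (om * l).
  by rewrite exprMn sqr_sqrtr ?mulr_ge0 ?ltW // expr2; lra.
have tau0 : 0 <= tau by rewrite mulr_ge0 // sqrtr_ge0.
have taup : 0 < tau by rewrite mulr_gt0 // sqrtr_gt0 mulr_gt0.
pose a := tau / (2 * om).
have a0 : 0 < a by rewrite divr_gt0 // mulr_gt0.
pose c := 3 * tau * s.
have om_neq0 : om != 0 by exact: lt0r_neq0.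
have ha1 : a * tau = 2 * l.
  by rewrite mulrAC -expr2 tau2; field.
have ha3 : a * c = 6 * (s * l).
  have -> : a * c = 3 * s * (a * tau) by rewrite /c; ring.
  by rewrite ha1; ring.
have ha2 : om * a ^+ 2 = l.
  by rewrite expr_div_n tau2; field.
pose n (k : {ffun 'I_d -> small_int d}) : 'rV[R]_d := grid_point k.
pose B k := [set t | tau * l2norm (n k) ^+ 2 + c < dotp (V t) (n k)].
have mB k : measurable (B k).
  rewrite (_ : B k = (fun t => dotp (V t) (n k)) @^-1` `]tau * l2norm (n k) ^+ 2 + c, +oo[).
    by rewrite -[X in measurable X]setTI; apply: mV.
  by apply/seteqP; split => t; rewrite /B /= in_itv /= andbT.
pose G (k : {ffun 'I_d -> small_int d}) : R :=
  \prod_i (if k i is inr (_, c) then q ^+ (c.+1 ^ 2) else 1).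
have GE k : expR (- (l * l2norm (n k) ^+ 2)) = G k.
  rewrite l2norm_sqr /dotp mulr_sumr -sumrN expR_sum; apply: eq_bigr => i _.
  rewrite mxE; case: (k i) => [[]|[b' e]] /=; first by rewrite !mulr0 oppr0 expR0.
  rewrite mulrACA -expr2 sqrr_sign mul1r -natrM mulnn -mulNr mulrC.
  by rewrite expRM_natl.
have PB k : (P (B k) <= (G k * expR (- (6 * N)))%:E)%E.
  have := markov_expR (a * (tau * l2norm (n k) ^+ 2 + c)) (mV (a *: n k)).
  have -> : [set t | a * (tau * l2norm (n k) ^+ 2 + c) < dotp (V t) (a *: n k)] = B k.
    by apply/seteqP; split => t; rewrite /B /= dotpZr ltr_pM2l.
  move=> /le_trans/(_ (mgf _)); rewrite l2normZ (gtr0_norm a0).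
  rewrite -[P (B k)]fineK ?fin_num_measure // -EFinM !lee_fin.
  set p := fine _; rewrite mulrC -ler_pdivlMr ?expR_gt0 // => h.
  apply: (le_trans h); rewrite -GE -expRN -!expRD ler_expR exprMn mulrA ha2.
  rewrite mulrDr mulrA ha1 le_eqVlt; apply/orP; left; apply/eqP.
  by rewrite ha3 /N; ring.
have mBU : measurable (\big[setU/set0]_k B k) by exact: bigsetU_measurable.
exists (~` \big[setU/set0]_k B k); split; first exact: measurableC.
  rewrite probability_setC // EFinB leeB //.
  apply: (le_trans (measure_bigsetU_le _ mB)).
  apply: (@le_trans _ _ (\sum_k (G k * expR (- (6 * N)))%:E)%E).
    by apply: lee_sum => k _; exact: PB.
  rewrite sumEFin lee_fin -mulr_suml.
  apply: (@le_trans _ _ (expR (4 * q * d%:R) * expR (- (6 * N)))).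
    by rewrite ler_wpM2r ?expR_ge0 //; exact: grid_sum_le.
  rewrite -expRD ler_expR qE (_ : 4 * (s / (2 * d%:R)) * d%:R = 2 * s); last first.
    by field; exact: lt0r_neq0.
  have : s * 2^-1 <= N by rewrite ler_wpM2l // ltW.
  lra.
move=> t Et u fu.
have HV k : dotp (V t) (grid_point k) <= tau * l2norm (grid_point k : 'rV[R]_d) ^+ 2 + c.
  rewrite leNgt; apply/negP => h; apply: Et.
  by rewrite (bigD1 k) //=; left.
have sq0 : 0 < Num.sqrt s by rewrite sqrtr_gt0.
have H := dotp_feasible_le s0 (ltW sd) tau0 HV fu.
rewrite -(ler_pM2l sq0); apply: (le_trans H).
have -> : Num.sqrt (om * N) = Num.sqrt s * Num.sqrt (om * l).
  by rewrite /N mulrCA sqrtrM // ltW.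
rewrite [leRHS](_ : _ = 16 * Num.sqrt (om * l) * Num.sqrt s ^+ 2); last by ring.
by rewrite (sqr_sqrtr (ltW s0)) /c /tau le_eqVlt; apply/orP; left; apply/eqP; ring.
Qed.

End subgaussian.

(** * The law of the answers *)

Section sample.
Context {R : realType} {d : nat} {dT dW : measure_display}.
Context {T : measurableType dT} {W : measurableType dW}.
Variables (P : probability T R) (Q : probability W R) (m : nat).
Variables (z : 'I_m -> {RV P >-> borel_rV R d}) (w : 'I_m -> {RV P >-> W}).
Hypothesis sample : direction_seed_sample Q z w.

Notation S := (@sphere R d).
Let mS : measurable S := measurable_sphere.

Definition direction_seed (i : 'I_m) (t : T) : borel_rV R d * W := (z i t, w i t).

Lemma measurable_direction_seed i : measurable_fun [set: T] (direction_seed i).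
Proof. exact: measurable_fun_pair. Qed.

Let mpre_z i (A : set (borel_rV R d)) : measurable A -> measurable (z i @^-1` A).
Proof. exact: measurable_funPTI. Qed.

Let mpre_w i (B : set W) : measurable B -> measurable (w i @^-1` B).
Proof. exact: measurable_funPTI. Qed.

Lemma direction_seed_rect i (A : set (borel_rV R d)) (B : set W) :
    measurable A -> measurable B ->
  P (direction_seed i @^-1` (A `*` B)) = (P (z i @^-1` A) * P (w i @^-1` B))%E.
Proof.
move=> mA mB.
have [_ _ /(_ [set inl i; inr i]%SET)] := sample.
pose Ev (k : 'I_m + 'I_m) : set T :=
  match k with inl j => z j @^-1` A | inr j => w j @^-1` B end.
move=> /(_ Ev) H.
have := H _; rewrite big_setU1 ?inE //= big_set1 => <-.
- congr (P _); apply/seteqP; split => t /=.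
    by move=> [tA tB] k /=; rewrite !inE => /orP[] /eqP ->.
  by move=> h; split; [apply: (h (inl i))|apply: (h (inr i))]; rewrite /= !inE eqxx ?orbT.
- move=> [j|j] _ /=.
    by exists A => //; rewrite setTI.
  by exists B => //; rewrite setTI.
Qed.

Definition rectangles : set (set (borel_rV R d * W)) :=
  [set A `*` B | A in measurable & B in measurable].

Lemma direction_seed_independent (A : 'I_m -> set (borel_rV R d * W)) :
    (forall i, rectangles (A i)) ->
  P (\bigcap_(i in [set: 'I_m]) (direction_seed i @^-1` A i))
    = (\prod_i P (direction_seed i @^-1` A i))%E.
Proof.
move=> rA.
have /choice[BC BCP] : forall i, exists BC : set (borel_rV R d) * set W,
    [/\ measurable BC.1, measurable BC.2 & BC.1 `*` BC.2 = A i].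
  by move=> i; have [B mB [C mC e]] := rA i; exists (B, C).
pose Ev (k : 'I_m + 'I_m) : set T :=
  match k with inl j => z j @^-1` (BC j).1 | inr j => w j @^-1` (BC j).2 end.
have [_ _ /(_ [set: 'I_m + 'I_m]%SET Ev) H] := sample.
transitivity (P (\bigcap_(k in [set` [set: 'I_m + 'I_m]%SET]) Ev k)).
  congr (P _); apply/seteqP; split => t h.
    move=> [j|j] _ /=; have [_ _ e] := BCP j; have := h j Logic.I; rewrite -e.
      by case.
    by case.
  move=> j _ /=; have [_ _ <-] := BCP j; split.
    by apply: (h (inl j)); rewrite /= inE.
  by apply: (h (inr j)); rewrite /= inE.
rewrite H; last first.
  move=> [j|j] _ /=; have [m1 m2 _] := BCP j.
    by exists (BC j).1 => //; rewrite setTI.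
  by exists (BC j).2 => //; rewrite setTI.
rewrite (eq_bigl predT); last by move=> k; rewrite inE.
rewrite big_sumType /= -big_split /=; apply: eq_bigr => i _.
by have [m1 m2 <-] := BCP i; rewrite direction_seed_rect.
Qed.

Lemma direction_seed_law i (A : set (borel_rV R d * W)) : measurable A ->
  (distribution P (z i) \x Q)%E A = P (direction_seed i @^-1` A).
Proof.
move=> mA.
have mi := measurable_direction_seed i.
apply: (product_measure_unique (m' := pushforward P (direction_seed i))) => //.
move=> B C mB mC; apply: (etrans (direction_seed_rect i mB mC)).
by congr (_ * _)%E; have [_ h _] := sample; exact: (h i C mC).
Qed.


Variables (f : 'rV[R]_d -> R) (b : bool) (oracle : W -> 'rV[R]_d -> 'rV[R]_d -> R).
Variables (x : 'rV[R]_d) (r p : R).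
Hypothesis oracle_pm : forall w x y, oracle w x y = 1 \/ oracle w x y = -1.
Hypothesis moracle : measurable_fun [set: W * (borel_rV R d * borel_rV R d)]
  (fun t => oracle t.1 t.2.1 t.2.2).
Hypothesis accuracy : forall x y, Q (correct_answer b f oracle x y) = p%:E.
Hypothesis df : forall y, differentiable f y.

Definition answer (u : borel_rV R d * W) : R := oracle u.2 x (x + r *: (u.1 : 'rV[R]_d)).

Lemma measurable_answer : measurable_fun [set: borel_rV R d * W] answer.
Proof.
have m2 : measurable_fun [set: borel_rV R d * W]
    (fun u => (x, x + r *: (u.1 : 'rV[R]_d)) : borel_rV R d * borel_rV R d).
  apply: measurable_fun_pair; first exact: measurable_cst.
  exact: (measurableT_comp (measurable_ray x r) measurable_fst).
exact: (measurableT_comp moracle (measurable_fun_pair measurable_snd m2)).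
Qed.

Lemma normr_answer u : `|answer u| = 1.
Proof.
by rewrite /answer; case: (oracle_pm u.2 x (x + r *: u.1)) => ->;
  rewrite ?normrN normr1.
Qed.

Definition response i (n : 'rV[R]_d) (t : T) : R :=
  answer (direction_seed i t) * dotp (z i t) n.

Lemma bm_response i (n : 'rV[R]_d) : bounded_measurable (z i @^-1` S) (response i n).
Proof.
apply: bmM; split.
- exact: (measurableT_comp measurable_answer (measurable_direction_seed i)).
- by exists 1 => t _; rewrite normr_answer.
- by apply: (measurableT_comp (measurable_dotp n)); exact: measurable_funPT.
- have [_ [K hK]] := @bm_dotp R d n.
  by exists K => t; exact: hK.
Qed.

Lemma mean_oracle (y : 'rV[R]_d) :
  mean Q setT (fun s => oracle s x y) = (2 * p - 1) * sign_pm b (f y - f x).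
Proof.
set e := sign_pm b (f y - f x).
pose C : set W := correct_answer b f oracle x y.
have my : measurable_fun [set: W] (fun s => oracle s x y).
  have mp : measurable_fun [set: W] (fun s => (s, (x, y)) : W * (borel_rV R d * borel_rV R d)).
    by apply: measurable_fun_pair => //; exact: measurable_cst.
  exact: (measurableT_comp moracle mp).
have mC : measurable C.
  have := my measurableT [set e] (measurable_set1 e); rewrite setTI.
  by congr measurable.
have b1 : bounded_measurable [set: W] (\1_C : W -> R).
  split; first exact: measurable_indic.
  by exists 1 => s _; rewrite indicE; case: (_ \in _); rewrite ?normr1 ?normr0.
have -> : mean Q setT (fun s => oracle s x y) = mean Q setT (fun s => e * (2 * \1_C s - 1)).
  apply: eq_mean => s _; rewrite indicE; have [sC|sC] := boolP (s \in C).
    by rewrite (set_mem sC : oracle s x y = e) /=; ring.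
  have {}sC : oracle s x y <> e by move=> h; move/negP: sC; apply; exact: mem_set.
  move: sC; rewrite /e; case: (sign_pm_or b (f y - f x)) => ->;
    by case: (oracle_pm s x y) => -> //; rewrite ?mulr0 ?sub0r ?mul1r ?mulrNN ?mulr1.
have QT : Q [set: W] = 1%E by exact: probability_setT.
rewrite meanZ //; last by apply: bmB; [exact: bmZ|exact: bm_cst].
rewrite meanB //; [|exact: bmZ|exact: bm_cst].
rewrite meanZ // (mean_cst measurableT QT).
have -> : mean Q setT (\1_C : W -> R) = p.
  rewrite /mean /Rintegral integral_indic // setIT.
  exact: (congr1 fine (accuracy x y)).
by rewrite mulrC.
Qed.

(** Given the direction, the answer is right with probability [p], whence the
    factor 2 p - 1; direction and seed are separated by Fubini. *)
Lemma mean_response i (n : 'rV[R]_d) :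
  mean P (z i @^-1` S) (response i n)
    = (2 * p - 1) *
      mean (distribution P (z i)) S (fun v => comparison f b x r v * dotp v n).
Proof.
pose h (v : borel_rV R d) : R := dotp v n * \1_S v.
have mh : measurable_fun [set: borel_rV R d] h.
  by apply: measurable_funM; [exact: measurable_dotp|exact: measurable_indic].
have [_ [K hK]] := @bm_dotp R d n.
have hb v : `|h v| <= `|K|.
  rewrite /h indicE; have [vS|vS] := boolP (v \in S).
    by rewrite mulr1 (le_trans (hK v (set_mem vS))) // ler_norm.
  by rewrite mulr0 normr0.
pose phi (u : borel_rV R d * W) : R := answer u * h u.1.
have mphi : measurable_fun setT phi.
  apply: measurable_funM; first exact: measurable_answer.
  exact: (measurableT_comp mh measurable_fst).
have phib u : `|phi u| <= `|K|.
  by rewrite /phi normrM normr_answer mul1r.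
have mE : measurable_fun setT (EFin \o phi) by exact/measurable_EFinP.
have mi := measurable_direction_seed i.
pose sQ := (distribution P (z i) \x Q)%E.
have isQ : sQ.-integrable setT (EFin \o phi).
  apply: measurable_bounded_integrable => //.
    have sQT : sQ setT = 1%E.
      exact: etrans (direction_seed_law i measurableT) (probability_setT P).
    by apply: (eq_ind_r (fun e => (e < +oo)%E) _ sQT); rewrite ltry.
  by exists `|K|; split; rewrite ?num_real // => M KM u _; exact: le_trans (phib u) (ltW KM).
have iP : P.-integrable (direction_seed i @^-1` setT) ((EFin \o phi) \o direction_seed i).
  apply: (@measurable_bounded_integrable _ _ _ P (phi \o direction_seed i)) => //.
  - by rewrite preimage_setT.
  - by rewrite preimage_setT; apply: (le_lt_trans (probability_le1 P measurableT)); rewrite ltry.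
  - apply: measurable_funTS.
  - exact: (measurableT_comp mphi mi).
  by exists `|K|; split; rewrite ?num_real // => M KM u _; exact: le_trans (phib _) (ltW KM).
have e1 := integral_pushforward mi mE iP measurableT.
rewrite preimage_setT in e1.
rewrite {1}/mean Rintegral_mkcond.
have -> : (response i n) \_ (z i @^-1` S)
    = phi \o direction_seed i.
  apply/funext => t; rewrite patchE /phi /h /= indicE.
  have [/set_mem tS|tS] := boolP (t \in _); first by rewrite mem_set // mulr1.
  by rewrite memNset ?mulr0 // => tS'; move/negP: tS; apply; exact: mem_set.
rewrite /Rintegral -e1.
have -> : (\int[pushforward P (direction_seed i)]_u (EFin \o phi) u
          = \int[sQ]_u (EFin \o phi) u)%E.
  by apply: eq_measure_integral => A mA _; exact: (esym (direction_seed_law i mA)).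
rewrite -integral12_prod_meas1 // /fubini_F.
have inner v : (\int[Q]_s (EFin \o phi) (v, s)
    = ((2 * p - 1) * (comparison f b x r v * h v))%:E)%E.
  have bo : bounded_measurable [set: W] (fun s => answer (v, s)).
    split; last by exists 1 => s _; rewrite normr_answer.
    exact: (measurableT_comp measurable_answer (measurable_pair1 v)).
  rewrite (_ : (\int[Q]_s (EFin \o phi) (v, s)) = \int[Q]_s (h v * answer (v, s))%:E)%E.
    have em : mean Q setT (fun s => answer (v, s)) = (2 * p - 1) * comparison f b x r v.
      exact: (mean_oracle (x + r *: (v : 'rV[R]_d))).
    by rewrite (mean_EFin Q measurableT (bmZ (h v) bo)) meanZ // em; congr EFin; ring.
  by apply: eq_integral => s _; rewrite /phi /= mulrC.
rewrite (eq_integral _ _ (fun v _ => inner v)).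
rewrite -/(Rintegral _ _ _).
have bch : bounded_measurable [set: borel_rV R d] (fun v => comparison f b x r v * h v).
  have [mc _] := bm_comparison b x r df.
  split; first exact: measurable_funM.
  by exists `|K| => v _; rewrite normrM normr_sign_pm mul1r.
rewrite -/(mean _ _ _) meanZ //; congr (_ * _).
rewrite /mean [RHS]Rintegral_mkcond; apply: eq_Rintegral => v _.
rewrite patchE /h indicE; case: ifPn => [vS|vS]; first by rewrite mulr1.
by rewrite !mulr0.
Qed.


Hypothesis d0 : (0 < d)%N.

Let PS i : P (z i @^-1` S) = 1%E.
Proof. by have [+ _ _] := sample; move=> /(_ i)[]. Qed.

Let mD i : measurable (z i @^-1` S). Proof. exact: mpre_z. Qed.

Lemma mean_preimage i (h : borel_rV R d -> R) : bounded_measurable S h ->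
  mean P (z i @^-1` S) (fun t => h (z i t)) = mean (distribution P (z i)) S h.
Proof.
move=> [mh [K hK]]; have mz : measurable_fun setT (z i) by exact: measurable_funPT.
have mE : measurable_fun setT (EFin \o h) by exact/measurable_EFinP.
have bh : bounded_measurable (z i @^-1` S) (h \o z i).
  by split; [exact: measurableT_comp|exists K => t; exact: hK].
have iP := bm_integrable P (mD i) bh.
have e := integral_pushforward mz mE iP mS.
by rewrite /mean /Rintegral -e.
Qed.

(** An answer only changes the sign of z.n, which cosh does not see. *)
Lemma centered_answer_mgf i (n : 'rV[R]_d) :
  (\int[P]_t (expR (response i n t - mean P (z i @^-1` S) (response i n)))%:E
    <= (expR (4 * (l2norm n ^+ 2 / d%:R)))%:E)%E.
Proof.
pose X := response i n; rewrite -/X; set mu := mean _ _ _.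
have bX : bounded_measurable (z i @^-1` S) X by exact: bm_response.
have bC : bounded_measurable (z i @^-1` S) (fun t => expR (X t - mu)).
  by apply: bm_expR; apply: bmB => //; exact: bm_cst.
have mC : measurable_fun setT (fun t => (expR (X t - mu))%:E).
  by apply/measurable_EFinP; case: bC.
have N0 : P (~` (z i @^-1` S)) = 0%E.
  by rewrite probability_setC // PS subee.
rewrite (ge0_negligible_integral (measurableC (mD i)) measurableT mC _ N0); last first.
  by move=> t _; rewrite lee_fin expR_ge0.
rewrite setTD setCK (mean_EFin P (mD i) bC) lee_fin.
have -> : mean P (z i @^-1` S) (fun t => expR (X t - mu)) =
    expR (- mu) * mean P (z i @^-1` S) (fun t => expR (X t)).
  rewrite -meanZ //; last exact: bm_expR.
  by apply: eq_mean => t _; rewrite addrC expRD.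
apply: (le_trans (centered_mgf_le (mD i) (PS i) bX)).
have -> : mean P (z i @^-1` S) (fun t => coshR (X t)) =
    mean (distribution P (z i)) S (fun v => coshR (dotp v n)).
  rewrite -mean_preimage; last by apply: bm_coshR; exact: bm_dotp.
  apply: eq_mean => t _; rewrite /X /response.
  by case: (oracle_pm (w i t) x (x + r *: (z i t : 'rV[R]_d))) => e;
    rewrite /answer /direction_seed /= e ?mul1r // mulN1r coshRN.
have us : uniform_on_sphere (distribution P (z i)) by have [+ _ _] := sample; exact.
have h := cosh_uniform_direction us d0 n.
have -> : 4 * (l2norm n ^+ 2 / d%:R) = 2 * (2 * (l2norm n ^+ 2 / d%:R)) by ring.
rewrite [leRHS]expRM_natl lerXn2r // nnegrE ?expR_ge0 //.
by rewrite /mean; apply: Rintegral_ge0 => v _; rewrite ltW // coshR_gt0.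
Qed.

Definition drift_vector i : 'rV[R]_d :=
  \row_j mean (distribution P (z i)) S (fun v => comparison f b x r v * v ord0 j).

Lemma dotp_drift_vector i (n : 'rV[R]_d) :
  dotp (drift_vector i) n =
    mean (distribution P (z i)) S (fun v => comparison f b x r v * dotp v n).
Proof.
have Sz : distribution P (z i) S = 1%E by exact: PS.
have bc := bm_comparison b x r df.
have bj j : bounded_measurable S (fun v : borel_rV R d => v ord0 j).
  have := @bm_dotp R d (delta_mx ord0 j); congr bounded_measurable.
  apply/funext => v; rewrite /dotp (bigD1 j) //= big1 ?addr0 => [|k kj].
    by rewrite mxE !eqxx mulr1.
  by rewrite mxE eqxx (negbTE kj) mulr0.
have bcj j : bounded_measurable S (fun v => n ord0 j * (comparison f b x r v * v ord0 j)).
  by apply: bmZ; exact: bmM.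
transitivity (mean (distribution P (z i)) S
    (fun v => \sum_j n ord0 j * (comparison f b x r v * v ord0 j))).
  rewrite (mean_sum mS Sz) //; apply: eq_bigr => j _.
  by rewrite mxE [LHS]mulrC meanZ //; exact: bmM.
apply: eq_mean => v _; rewrite mulr_sumr; apply: eq_bigr => j _; ring.
Qed.

Definition deviation (t : T) : 'rV[R]_d :=
  \sum_i (answer (direction_seed i t) *: (z i t : 'rV[R]_d)
          - (2 * p - 1) *: drift_vector i).

Lemma dotp_deviation t (n : 'rV[R]_d) :
  dotp (deviation t) n = \sum_i
    (response i n t - mean P (z i @^-1` S) (response i n)).
Proof.
rewrite dotp_suml; apply: eq_bigr => i _.
by rewrite dotpBl !dotpZl dotp_drift_vector mean_response.
Qed.

Lemma measurable_dotp_deviation (n : 'rV[R]_d) :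
  measurable_fun [set: T] (fun t => dotp (deviation t) n).
Proof.
under eq_fun do rewrite dotp_deviation.
apply: measurable_sum => i; apply: measurable_funB; last exact: measurable_cst.
by case: (bm_response i n).
Qed.

Lemma deviation_mgf (n : 'rV[R]_d) :
  (\int[P]_t (expR (dotp (deviation t) n))%:E
    <= (expR (4 * m%:R / d%:R * l2norm n ^+ 2))%:E)%E.
Proof.
pose mu i := mean P (z i @^-1` S) (response i n).
pose F i (u : borel_rV R d * W) := expR (answer u * dotp u.1 n - mu i).
have mF i : measurable_fun setT (F i).
  apply: (measurableT_comp (@measurable_expR R)).
  apply: measurable_funB; last exact: measurable_cst.
  apply: measurable_funM; first exact: measurable_answer.
  exact: (measurableT_comp (measurable_dotp n) measurable_fst).
have F0 i u : 0 <= F i u by exact: expR_ge0.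
have Fle i : (\int[P]_t (F i (direction_seed i t))%:E
    <= (expR (4 * (l2norm n ^+ 2 / d%:R)))%:E)%E by exact: centered_answer_mgf.
have Fge i : (0 <= \int[P]_t (F i (direction_seed i t))%:E)%E.
  by apply: integral_ge0 => t _; rewrite lee_fin.
pose e i := fine (\int[P]_t (F i (direction_seed i t))%:E)%E.
have eE i : (\int[P]_t (F i (direction_seed i t))%:E = (e i)%:E)%E.
  by rewrite /e fineK // ge0_fin_numE // (le_lt_trans (Fle i)) // ltry.
have mK : @measurable _ (borel_rV R d * W)%type = <<s rectangles >>.
  exact: measurable_prod_measurableType.
have IK : setI_closed rectangles.
  move=> _ _ [A mA [B mB <-]] [A' mA' [B' mB' <-]].
  by exists (A `&` A'); [exact: measurableI|exists (B `&` B'); [exact: measurableI|rewrite setXI]].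
have KT : rectangles setT.
  by exists setT => //; exists setT => //; rewrite setXTT.
have := independent_integral_prod measurable_direction_seed mK IK KT
  direction_seed_independent mF F0 eE.
have -> : (fun t => (\prod_i F i (direction_seed i t))%:E)
        = (fun t => (expR (dotp (deviation t) n))%:E).
  by apply/funext => t; rewrite dotp_deviation expR_sum.
move=> ->; rewrite lee_fin.
apply: (@le_trans _ _ (\prod_(i < m) expR (4 * (l2norm n ^+ 2 / d%:R)))).
  apply: ler_prod => i _; apply/andP; split.
    by rewrite -lee_fin -eE.
  by rewrite -lee_fin -eE.
rewrite prodr_const card_ord -expRM_natr ler_expR.
by rewrite le_eqVlt; apply/orP; left; apply/eqP; ring.
Qed.

End sample.

(** * Conclusion *)

(** A vector [e] whose length nearly equals its component along [gb] makes a
    small angle with [gb], so among vectors of length at most 1 those far from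
    [gb] have a definitely smaller inner product with [e]. *)
Lemma nearly_aligned_gap (R : realType) (d : nat) (e gb u : 'rV[R]_d) (k eta : R) :
    0 < l2norm e -> l2norm gb = 1 -> l2norm u <= 1 ->
    l2norm e <= dotp e gb + k * l2norm e -> k <= eta ^+ 2 / 16 ->
    0 < eta -> eta < l2norm (u - gb) ->
  dotp e (u - gb) <= - (l2norm e * (eta ^+ 2 / 16)).
Proof.
move=> e0 gb1 u1 ek keta eta0 ugb.
pose eb := (l2norm e)^-1 *: e.
have eE : e = l2norm e *: eb by rewrite /eb scalerA mulfV ?scale1r // lt0r_neq0.
have eb1 : l2norm eb = 1.
  by rewrite l2normZ ger0_norm ?invr_ge0 ?l2norm_ge0 // mulVf // lt0r_neq0.
have k1 : 1 - k <= dotp eb gb.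
  rewrite -(ler_pM2l e0) mulrBr mulr1.
  by move: ek; rewrite {2}eE dotpZl; lra.
have h1 : l2norm (eb - gb) ^+ 2 <= (eta / 2) ^+ 2.
  rewrite l2normB_sqr eb1 gb1; have := sqr_ge0 eta.
  by move: keta; rewrite !expr2; lra.
have {}h1 : l2norm (eb - gb) <= eta / 2.
  by rewrite -(@ler_pXn2r _ 2) ?nnegrE ?l2norm_ge0 // divr_ge0 // ltW.
have h2 : eta / 2 <= l2norm (u - eb).
  have := ler_l2normD (u - eb) (eb - gb); rewrite addrA subrK; lra.
have {}h2 : (eta / 2) ^+ 2 <= l2norm (u - eb) ^+ 2.
  by rewrite lerXn2r // nnegrE ?l2norm_ge0 // divr_ge0 // ltW.
have h3 : l2norm u ^+ 2 <= 1 by rewrite expr_le1 // l2norm_ge0.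
rewrite l2normB_sqr eb1 in h2.
rewrite [in dotp e _]eE dotpZl -mulrN ler_pM2l // dotpBr (dotpC eb u).
by move: h2 h3 keta; rewrite !expr2; lra.
Qed.

Lemma one_bit_objectiveE (R : realType) (d m : nat) (z : 'I_m -> 'rV[R]_d)
    (y : 'I_m -> R) (g : 'rV[R]_d) :
  one_bit_objective z y g = dotp (\sum_i y i *: z i) g.
Proof. by rewrite dotp_suml; apply: eq_bigr => i _; rewrite dotpZl. Qed.

Lemma one_le_8expRN (R : realType) (t : R) : t <= 1 -> 1 <= 8 * expR (- t).
Proof.
move=> t1; apply: (@le_trans _ _ (8 * expR (- 1))); last first.
  by rewrite ler_pM2l // ler_expR lerN2.
rewrite expRN -ler_pdivrMr ?invr_gt0 ?expR_gt0 // invrK mul1r.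
have h : expR (2^-1) <= 2 :> R.
  rewrite -[X in expR X]opprK expRN -[leRHS]invrK.
  rewrite lef_pV2 ?posrE ?expR_gt0 ?invr_gt0 //.
  by apply: le_trans (expR_ge1Dx _); lra.
have -> : expR 1 = expR 2^-1 ^+ 2 :> R.
  by rewrite -expRM_natr; congr expR; field.
apply: (@le_trans _ _ (2 ^+ 2)); first by rewrite lerXn2r ?nnegrE ?expR_ge0.
by rewrite expr2; lra.
Qed.

(** With the prescribed number [m] of queries, the deviation (left) is smaller
    than the gap left by the mean (right); squared, the two sides differ by a
    factor 4. *)
Lemma sample_size_gap (R : realType) (c0 delta0 eta N D m : R) :
    0 < D -> 0 < c0 -> 0 < delta0 -> 0 < eta -> 0 < N ->
    4 * (8 ^+ 3 / c0) ^+ 2 * eta ^- 4 * delta0 ^- 2 * N <= m ->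
  32 * Num.sqrt (4 * m / D * N)
    < 2 * delta0 * (m * (c0 / Num.sqrt D) * (eta ^+ 2 / 16)).
Proof.
move=> D0 c00 delta00 eta0 N0 mge.
have dn0 : delta0 != 0 by exact: lt0r_neq0.
have en0 : eta != 0 by exact: lt0r_neq0.
have cn0 : c0 != 0 by exact: lt0r_neq0.
have Dn0 : D != 0 by exact: lt0r_neq0.
have sD : 0 < Num.sqrt D by rewrite sqrtr_gt0.
have K0 : 0 < (8 ^+ 3) ^+ 2 * N by rewrite mulr_gt0 // !exprn_gt0.
have k0 : 0 < delta0 ^+ 2 * eta ^+ 4 * c0 ^+ 2 by rewrite !mulr_gt0 ?exprn_gt0.
have {}mge : 4 * ((8 ^+ 3) ^+ 2 * N) <= delta0 ^+ 2 * eta ^+ 4 * c0 ^+ 2 * m.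
  rewrite -(ler_pM2l k0) in mge; apply: le_trans mge.
  by rewrite le_eqVlt; apply/orP; left; apply/eqP; field; rewrite cn0 dn0 en0.
have m0 : 0 < m.
  by rewrite -(pmulr_rgt0 _ k0); apply: lt_le_trans mge; rewrite pmulr_rgt0.
have L0 : 0 <= 32 * Num.sqrt (4 * m / D * N) by rewrite mulr_ge0 // sqrtr_ge0.
have R0 : 0 <= 2 * delta0 * (m * (c0 / Num.sqrt D) * (eta ^+ 2 / 16)).
  by rewrite !mulr_ge0 ?divr_ge0 ?exprn_ge0 // ltW.
have omN0 : 0 <= 4 * m / D * N by rewrite !mulr_ge0 ?invr_ge0 // ltW.
rewrite -(@ltr_pXn2r _ 2) ?nnegrE // [ltLHS]exprMn (sqr_sqrtr omN0).
rewrite [ltRHS](_ : _ = m / (64 * D) * (delta0 ^+ 2 * eta ^+ 4 * c0 ^+ 2 * m));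
  last by rewrite -[in RHS](sqr_sqrtr (ltW D0)); field; exact: lt0r_neq0.
rewrite [ltLHS](_ : _ = m / (64 * D) * ((8 ^+ 3) ^+ 2 * N)); last by field.
rewrite ltr_pM2l ?divr_gt0 ?mulr_gt0 //; apply: lt_le_trans mge.
by move: K0; set A := _ * N; lra.
Qed.

Theorem theorem3p9 (R : realType) :
  exists C c : R, 0 < C /\ 0 < c /\
  forall (d : nat) (s nu L : R) (f : 'rV[R]_d -> R)
    (b : bool) (dW : measure_display) (W : measurableType dW)
    (Q : probability W R) (oracle : W -> 'rV[R]_d -> 'rV[R]_d -> R)
    (delta0 mu eps eta : R) (x : 'rV[R]_d) (m : nat)
    (dT : measure_display) (T : measurableType dT) (P : probability T R)
    (z : 'I_m -> {RV P >-> borel_rV R d}) (w : 'I_m -> {RV P >-> W})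
    (ghat : T -> 'rV[R]_d),
    let g := gradient f x in
    let r := eps * nu / (2 * L * Num.sqrt d%:R) in
    0 < s -> s < d%:R ->
    0 < nu -> nu <= L ->
    F_class L nu f -> CG s f ->
    poly_comparison_oracle b f Q oracle delta0 mu 1 ->
    constant_accuracy b f Q oracle ->
    0 < delta0 -> delta0 < mu -> mu <= 2^-1 ->
    0 < eps -> 0 < eta -> eta < 1 ->
    eps * nu / 2 <= l2norm g ->
    4 * C * eta ^- 4 * delta0 ^- 2 * s * ln (2 * d%:R / s) <= m%:R ->
    direction_seed_sample Q z w ->
    (forall t : T, one_bit_grad_est oracle x s r
                     (fun i => z i t) (fun i => w i t) (ghat t)) ->
    with_probability_at_least P
      (1 - 8 * expR (- (c * eta ^+ 4 * s * ln (2 * d%:R / s))))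
      [set t | l2norm (ghat t - (l2norm g)^-1 *: g) <= eta].
Proof.
pose c0 := drift_constant R.
have c00 : 0 < c0 by exact: drift_constant_gt0.
have c01 : c0 <= 1.
  have e1 : 1 <= expR 1 :> R by rewrite -[X in X <= _]expR0 ler_expR.
  rewrite /c0 /drift_constant ler_pdivrMr ?mulr_gt0 ?expR_gt0 //; lra.
(* c is used in [small], where 1 / (2 c) is the least admissible eta^4 d, and C
   is the constant of [sample_size_gap]. *)
pose c := (c0 / 32) ^+ 2 / 2.
pose C := (8 ^+ 3 / c0) ^+ 2.
have cp : 0 < c by rewrite divr_gt0 // exprn_gt0 // divr_gt0.
have Cp : 0 < C by rewrite exprn_gt0 // divr_gt0 // exprn_gt0.
exists C, c; split => //; split => //.
move=> d s nu L f b dW W Q oracle delta0 mu eps eta x m dT T P z w ghat g r.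
move=> s0 sd nu0 nuL Ff [_ CGf] orc [p accuracy] delta00 dmu _ eps0 eta0 eta1.
move=> gge mge sample est.
set l := ln (2 * d%:R / s) in mge *.
have pd : 0 < (d%:R : R) by exact: lt_trans sd.
have d0 : (0 < d)%N by rewrite -(ltr_nat R).
have L0 : 0 < L by exact: lt_le_trans nuL.
have df y : differentiable f y by case: (F_C2 Ff) => + _ _; exact.
have g0 : 0 < l2norm g by apply: lt_le_trans gge; rewrite divr_gt0 // mulr_gt0.
have sqd : 0 < Num.sqrt d%:R :> R by rewrite sqrtr_gt0.
have r0 : 0 < r by rewrite divr_gt0 ?mulr_gt0.
have Lr : L * r * Num.sqrt d%:R <= l2norm g.
  apply: le_trans gge; rewrite le_eqVlt; apply/orP; left; apply/eqP.
  by rewrite /r; field; rewrite !lt0r_neq0.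
pose gb := (l2norm g)^-1 *: g.
have gb1 : l2norm gb = 1.
  by rewrite l2normZ ger0_norm ?invr_ge0 ?l2norm_ge0 // mulVf ?lt0r_neq0.
have gbl1 : l1norm gb <= Num.sqrt s.
  rewrite /l1norm; under eq_bigr do rewrite mxE normrM.
  rewrite -mulr_sumr ger0_norm ?invr_ge0 ?l2norm_ge0 // mulrC ler_pdivrMr //.
  exact: CGf.
have fgb : one_bit_feasible s gb by split; rewrite ?gb1.
have fNgb : one_bit_feasible s (- gb).
  split; last by rewrite l2normN gb1.
  by rewrite /l1norm; under eq_bigr do rewrite mxE normrN.
have x0 : 0 < 2 * d%:R / s by rewrite divr_gt0 // mulr_gt0.
have l0 : 0 < l.
  by rewrite ln_gt0 // ltr_pdivlMr // mul1r; lra.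
pose N := s * l.
have N0 : 0 < N by rewrite mulr_gt0.
have N2d : N <= 2 * d%:R.
  have : l <= 2 * d%:R / s.
    apply: le_trans (_ : expR l - 1 <= _).
      by have := expR_ge1Dx l; lra.
    by rewrite lnK ?posrE // gerBl.
  by rewrite /N ler_pdivlMr // mulrC.
have p2 : 2 * delta0 <= 2 * p - 1.
  have := oracle_correct orc x x; rewrite accuracy lee_fin !subrr powRr0 mulr1.
  by rewrite min_l ?(ltW dmu) //; lra.
have eta4 : 0 < eta ^+ 4 by exact: exprn_gt0.
have eta2 : 0 < eta ^+ 2 by exact: exprn_gt0.
have -> : c * eta ^+ 4 * s * l = c * eta ^+ 4 * N by rewrite /N mulrA.
(* If c eta^4 N <= 1, then the claimed probability is at most 1 - 8 / e < 0.
   Otherwise N <= 2 d forces d >= 1 / (2 c eta^4), which makes the angle between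
   the mean answer and the gradient small compared to eta. *)
have [triv|nontriv] := leP (c * eta ^+ 4 * N) 1.
  exists set0; split => //; rewrite measure0 lee_fin subr_le0.
  exact: one_le_8expRN.
have m0 : 0 < (m%:R : R).
  apply: lt_le_trans mge; rewrite -mulrA pmulr_rgt0 // !mulr_gt0 ?invr_gt0 ?exprn_gt0 //.
pose V := deviation z w f b oracle x r p.
pose om := 4 * m%:R / d%:R : R.
have om0 : 0 < om by rewrite divr_gt0 // mulr_gt0.
have opm := oracle_pm1 orc; have om' := oracle_measurable orc.
have [E [mE PE HE]] := subgaussian_feasible_le om0 s0 sd
  (measurable_dotp_deviation sample x r opm om' accuracy df)
  (deviation_mgf sample x r opm om' accuracy df d0).
exists E; split => //; last first.
  apply: le_trans PE; rewrite lee_fin lerD2l lerN2 -/l -/N.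
  rewrite -[leLHS]mul1r ler_pM ?expR_ge0 //; first by lra.
  rewrite ler_expR lerN2 ler_wpM2r ?(ltW N0) //.
  apply: (@le_trans _ _ 1); last by lra.
  rewrite -[leRHS]mulr1 ler_pM ?(ltW cp) ?(ltW eta4) //.
    rewrite /c ler_pdivrMr // mul1r; apply: (@le_trans _ _ 1); last by lra.
    by rewrite expr_le1 // ?divr_ge0 ?(ltW c00) // ler_pdivrMr // mul1r; lra.
  by rewrite expr_le1 ?ltW.
move=> t Et /=; rewrite -/gb leNgt; apply/negP => far.
have [fh opt] := est t.
pose e := \sum_i drift_vector z f b x r i.
have objE u : one_bit_objective (fun i => z i t)
    (fun i => oracle (w i t) x (x + r *: (z i t : 'rV[R]_d))) u
    = dotp (V t) u + (2 * p - 1) * dotp e u.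
  rewrite one_bit_objectiveE -dotpZl -dotpDl; congr dotp.
  rewrite /V /deviation /e scaler_sumr -big_split /=; apply: eq_bigr => i _.
  by rewrite subrK.
have us i : uniform_on_sphere (distribution P (z i)) by case: sample => + _ _; exact.
have dotpe u : dotp e u = \sum_i mean (distribution P (z i)) (@sphere R d)
    (fun v => comparison f b x r v * dotp v u).
  by rewrite dotp_suml; apply: eq_bigr => i _; rewrite (dotp_drift_vector sample b x r df).
have drift_max u : l2norm u = 1 -> dotp e u <= dotp e gb + 2 * m%:R / d%:R.
  move=> u1; rewrite !dotpe.
  have -> : 2 * m%:R / d%:R = \sum_(i < m) (2 / d%:R) :> R.
    by rewrite sumr_const card_ord -mulr_natr; ring.
  rewrite -big_split; apply: ler_sum => i _.
  exact: (comparison_maximizer b (us i) d0 df (ltW L0) r0 (F_lipschitz_gradient Ff) g0 Lr u1).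
have drift_min : m%:R * (c0 / Num.sqrt d%:R) <= dotp e gb.
  rewrite dotpe; have -> : m%:R * (c0 / Num.sqrt d%:R) = \sum_(i < m) (c0 / Num.sqrt d%:R).
    by rewrite sumr_const card_ord mulr_natl.
  apply: ler_sum => i _.
  exact: (comparison_drift b (us i) d0 df (ltW L0) r0 (F_lipschitz_gradient Ff)
    (F_convex Ff) g0 Lr).
have e_ge : m%:R * (c0 / Num.sqrt d%:R) <= l2norm e.
  apply: (le_trans drift_min); apply: (le_trans (CauchySchwarz_dotp _ _)).
  by rewrite gb1 mulr1.
have e0 : 0 < l2norm e by apply: lt_le_trans e_ge; rewrite mulr_gt0 // divr_gt0.
have e_le : l2norm e <= dotp e gb + 2 / (c0 * Num.sqrt d%:R) * l2norm e.
  have := drift_max ((l2norm e)^-1 *: e).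
  rewrite l2normZ ger0_norm ?invr_ge0 ?l2norm_ge0 // mulVf ?lt0r_neq0 // => /(_ erefl).
  rewrite dotpZr -l2norm_sqr expr2 mulrA mulVf ?lt0r_neq0 // mul1r => /le_trans; apply.
  rewrite lerD2l; apply: le_trans (_ : 2 / (c0 * Num.sqrt d%:R) * (m%:R * (c0 / Num.sqrt d%:R)) <= _).
    rewrite le_eqVlt; apply/orP; left; apply/eqP.
    rewrite -[X in _ / X](sqr_sqrtr (ltW pd)); field.
    by rewrite !lt0r_neq0.
  by rewrite ler_wpM2l // divr_ge0 // mulr_ge0 // ltW.
have small : 2 / (c0 * Num.sqrt d%:R) <= eta ^+ 2 / 16.
  rewrite ler_pdivrMr ?mulr_gt0 //.
  have : 32 / c0 <= eta ^+ 2 * Num.sqrt d%:R.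
    have q1 : 0 <= 32 / c0 by rewrite divr_ge0 // ltW.
    have q2 : 0 <= eta ^+ 2 * Num.sqrt d%:R by rewrite mulr_ge0 // ltW.
    rewrite -(@ler_pXn2r _ 2) ?nnegrE //.
    rewrite [leRHS]exprMn sqr_sqrtr ?(ltW pd) // -exprM.
    have : 1 <= c * eta ^+ 4 * (2 * d%:R).
      by apply: (le_trans (ltW nontriv)); rewrite ler_wpM2l // mulr_ge0 ?ltW.
    rewrite /c => h; rewrite -[leLHS]mul1r.
    rewrite -[32 / c0]invf_div exprVn ler_pdivrMr ?exprn_gt0 ?divr_gt0 //.
    by apply: (le_trans h); rewrite le_eqVlt; apply/orP; left; apply/eqP; field.
  by rewrite ler_pdivrMr //; clear; lra.
have gap := nearly_aligned_gap e0 gb1 fh.2 e_le small eta0 far.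
have dev : dotp (V t) (ghat t - gb) <= 32 * Num.sqrt (om * N).
  rewrite dotpDr; have := HE t Et _ fh; have := HE t Et _ fNgb; rewrite -/l -/N; clear; lra.
have main : 2 * delta0 * (m%:R * (c0 / Num.sqrt d%:R) * (eta ^+ 2 / 16))
    <= 32 * Num.sqrt (om * N).
  have := opt gb fgb; rewrite !objE -subr_ge0 => H.
  have {}H : 0 <= dotp (V t) (ghat t - gb) + (2 * p - 1) * dotp e (ghat t - gb).
    by move: H; rewrite !dotpBr mulrBr; clear; lra.
  have h1 : 2 * delta0 * (m%:R * (c0 / Num.sqrt d%:R) * (eta ^+ 2 / 16))
      <= (2 * p - 1) * (l2norm e * (eta ^+ 2 / 16)).
    apply: ler_pM => //.
    - by rewrite mulr_ge0 // ltW.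
    - by rewrite !mulr_ge0 ?divr_ge0 // ?ltW.
    - by rewrite ler_wpM2r // divr_ge0 // ltW.
  have h2 : (2 * p - 1) * dotp e (ghat t - gb)
      <= - ((2 * p - 1) * (l2norm e * (eta ^+ 2 / 16))).
    rewrite -mulrN ler_wpM2l //; apply: le_trans p2; by rewrite mulr_ge0 // ltW.
  by move: H h1 h2 dev; clear; lra.
by move: main; rewrite leNgt (sample_size_gap pd c00 delta00 eta0 N0) // /N mulrA.
Qed.
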